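(* Let $\operatorname{Re} a>0$. Then $$\gamma_0(a)=\frac{1}{2a}-\ln a+\frac{1}{2\pi^2a^2}\sum_{n=0}^\infty\frac{(2n+1)!\,(-1)^n}{(2\pi a)^{2n}}\,\zeta(2n+2).$$
   Context: The Hurwitz zeta function is $\zeta(s,a)=\sum_{n=0}^\infty (n+a)^{-s}$ for $\operatorname{Re} s>1$, continued analytically in $s$, with a simple pole at $s=1$. The Stieltjes constants $\gamma_n(a)$, $n\ge 0$, are defined by the Laurent expansion about $s=1$, $$\zeta(s,a)=\frac{1}{s-1}+\sum_{n=0}^\infty\frac{(-1)^n}{n!}\gamma_n(a)(s-1)^n,$$ and $\gamma_0(a)=-\psi(a)$ with $\psi=\Gamma'/\Gamma$ the digamma function. $\zeta(s)=\zeta(s,1)$ is the Riemann zeta function. The author remarks that this formula may be considered the expansion of $\gamma_0(a)$, or of the digamma function, about $|a|\to\infty$ with $\arg a<\pi$.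
   Formalization: The displayed series diverges for every a, so the equality is read as a Poincaré asymptotic expansion: as |a|→∞ with Re a>0, for each N the remainder after the terms n=0,…,N is negligible compared with the N-th term. *)

(* Defs.v *)
From Stdlib Require Import Reals Factorial.
From Coquelicot Require Export Coquelicot.
Open Scope R_scope.

(** Principal argument, in (-PI, PI]; the junk value at 0 is never used. *)
Definition Carg (z : C) : R :=
  if Rle_dec 0 (Im z) then acos (Re z / Cmod z) else - acos (Re z / Cmod z).

Definition Cexp (z : C) : C := (exp (Re z) * cos (Im z), exp (Re z) * sin (Im z)).

Definition Clog (z : C) : C := (ln (Cmod z), Carg z).

Definition Cpower (z w : C) : C := Cexp (w * Clog z)%C.

(** [Z] is s |-> zeta(s,a).  The value [Z 1] is left unconstrained, and the
    two clauses determine [Z] on C \ {1} since that set is connected. *)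
Definition is_hurwitz_zeta (a : C) (Z : C -> C) : Prop :=
  (forall s : C, 1 < Re s ->
     is_series (V := C_NormedModule)
       (fun n : nat => Cpower (INR n + a)%C (- s)%C) (Z s)) /\
  (forall s : C, s <> 1 -> ex_derive (K := C_AbsRing) (V := C_NormedModule) Z s).

(** [g n] is the n-th Stieltjes constant attached to [Z]: the Laurent expansion
    of [Z] holds on some punctured disc around 1. *)
Definition is_stieltjes (Z : C -> C) (g : nat -> C) : Prop :=
  locally' (T := C_UniformSpace) (RtoC 1) (fun s : C =>
    is_pseries (K := C_AbsRing) (V := C_NormedModule)
      (fun n : nat => ((-1) ^ n / INR (fact n) * g n)%C)
      (s - 1)%C
      (Z s - 1 / (s - 1))%C).

(** The filter of |a| -> infinity, with a in the right half-plane. *)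
Definition right_half_plane_infinity : (C -> Prop) -> Prop :=
  within (fun a : C => 0 < Re a)
    (fun P : C -> Prop => exists M : R, forall a : C, M < Cmod a -> P a).

(** Poincare asymptotic expansion f ~ f0 + sum_(n >= 0) u n along [F]: the
    remainder after each partial sum is negligible with respect to the last term
    retained. The series itself is not required to converge. *)
Definition asymptotic_expansion (F : (C -> Prop) -> Prop)
    (f f0 : C -> C) (u : nat -> C -> C) : Prop :=
  forall N : nat,
    is_domin (Ku := C_AbsRing) (Kv := C_AbsRing)
      (U := C_NormedModule) (V := C_NormedModule) F
      (u N)
      (fun a : C => f a - (f0 a + sum_n (fun n : nat => u n a) N))%C.

(* Main.v *)
Require Import Defs.
From Stdlib Require Import Reals Factorial Lra Lia Psatz.
From Coquelicot Require Import Coquelicot.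
Open Scope R_scope.

(** Write R_N(a) for the remainder after the terms u_0, ..., u_N. Since the
    differences gamma_0(a) - gamma_0(a+1) = 1/a and u_n(a) - u_n(a+1) are explicit,
    R_N(a) - R_N(a+1) is the error of the Euler-Maclaurin formula for 1/(x+a) on
    [0,1]. Integrating by parts against the Fourier series of the Bernoulli
    polynomial B_2 puts zeta(2n+2) directly in place of the Bernoulli numbers and
    bounds this error by a multiple of |a|^(-2N-4), uniformly on the half-plane.
    Summing over a, a+1, a+2, ... gives R_N(a) = O(|a|^(-2N-3)), because
    R_N(a+m) -> 0; the latter follows from gamma_0(b) + ln b -> 0, obtained by
    comparing the series of zeta(s,b) with the integral of (x+b)^(-s) and letting
    s decrease to 1. The continuation of zeta(s,a) plays no role beyond the limit
    at 1. *)

(** * Fourier series of the second Bernoulli polynomial *)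

(** The required bound is relative to the last retained term, which has exact size |a|^(-2N-2) only
    because zeta(2N+2) is not 0; a single spare power of |a| then suffices, and all constants may
    depend on N. The obstacle is the sawtooth 1/2 - x met in the first integration by parts: its
    Fourier series does not converge uniformly on [0,1]. All series are therefore cut to M terms, so
    that they can be differentiated term by term, and the sawtooth is compared with its truncation
    only through a primitive, where the cut costs O(1/M) uniformly. The limit in M is taken last,
    with N and a fixed. No integral is formed: every integral estimate is a mean value inequality
    for an explicit primitive on [0,1]. Uniformity up to the imaginary axis rests on |x+a|^2 >= x^2
    + |a|^2 for x >= 0. *)

Fixpoint Rsum (u : nat -> R) (n : nat) : R :=
  match n with O => 0 | S n => Rsum u n + u n end.

Lemma Rsum_abs_le (u v : nat -> R) (n : nat) :
  (forall k, Rabs (u k) <= v k) -> Rabs (Rsum u n) <= Rsum v n.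
Proof.
  intros H; induction n as [|n IH]; simpl; [rewrite Rabs_R0; lra|].
  eapply Rle_trans; [apply Rabs_triang|]. specialize (H n). lra.
Qed.

Lemma Rsum_scal (c : R) (u : nat -> R) (n : nat) :
  Rsum (fun k => c * u k) n = c * Rsum u n.
Proof. induction n as [|n IH]; simpl; [|rewrite IH]; ring. Qed.

Lemma Rsum_ext (u v : nat -> R) (n : nat) :
  (forall k, u k = v k) -> Rsum u n = Rsum v n.
Proof. intros H; induction n as [|n IH]; simpl; [|rewrite IH, H]; reflexivity. Qed.

Lemma Rsum_add (u : nat -> R) (m n : nat) :
  Rsum u (m + n) = Rsum u m + Rsum (fun k => u (m + k)%nat) n.
Proof.
  induction n as [|n IH]; simpl; [rewrite Nat.add_0_r; ring|].
  rewrite Nat.add_succ_r; simpl; rewrite IH; ring.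
Qed.

Lemma Rsum_inv_sq_le (p : R) (n : nat) :
  1 < p -> Rsum (fun k => / (INR k + p) ^ 2) n <= / (p - 1).
Proof.
  intros Hp.
  (* Keeping the subtracted term makes the induction telescope, by 1/y^2 <= 1/(y-1) - 1/y. *)
  assert (H : Rsum (fun k => / (INR k + p) ^ 2) n <= / (p - 1) - / (INR n + p - 1)).
  { induction n as [|n IH]; cbn [Rsum]; [simpl; rewrite Rplus_0_l; lra|].
    rewrite S_INR. assert (Hn := pos_INR n).
    enough (/ (INR n + p) ^ 2 <= / (INR n + p - 1) - / (INR n + 1 + p - 1)) by lra.
    replace (/ (INR n + p - 1) - / (INR n + 1 + p - 1))
      with (/ ((INR n + p - 1) * (INR n + p))) by (field; lra).
    apply Rinv_le_contravar; nra. }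
  assert (0 < / (INR n + p - 1)) by (apply Rinv_0_lt_compat; assert (Hn := pos_INR n); lra).
  lra.
Qed.

Lemma is_derive_Rsum (u du : nat -> R -> R) (x : R) (n : nat) :
  (forall k, is_derive (u k) x (du k x)) ->
  is_derive (fun t => Rsum (fun k => u k t) n) x (Rsum (fun k => du k x) n).
Proof.
  intros H; induction n as [|n IH]; simpl.
  - apply (is_derive_const (K := R_AbsRing) (V := R_NormedModule)).
  - apply (is_derive_plus (K := R_AbsRing) (V := R_NormedModule)); [apply IH|apply H].
Qed.

(** The derivative is bounded on the open interval only, because the Fourier estimate
    [cos_sum_bernoulli] used later holds for 0 < x < 1. *)
Lemma mean_value_bound (g dg : R -> R) (a b B : R) :
  a <= b ->
  (forall x, a <= x <= b -> is_derive g x (dg x)) ->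
  (forall x, a < x < b -> Rabs (dg x) <= B) ->
  Rabs (g b - g a) <= B * (b - a).
Proof.
  intros Hab Hd HB. destruct (Req_dec a b) as [<-|Hne].
  { replace (g a - g a) with 0 by ring. rewrite Rabs_R0; lra. }
  destruct (MVT_cor2 g dg a b) as [c [Hc Hin]]; [lra| |].
  { intros c Hc; apply is_derive_Reals, Hd, Hc. }
  rewrite Hc, Rabs_mult, (Rabs_pos_eq (b - a)) by lra.
  apply Rmult_le_compat_r; [lra|]. apply HB, Hin.
Qed.

(** * Truncated Fourier series of the Bernoulli polynomials *)

Definition freq (k : nat) : R := 2 * PI * INR (S k).

(** On [0,1] and for even j >= 2 this tends in M to (-1)^(j/2+1) B_j(x)/j!; the odd polynomials come
    from [sin_sum]. With this normalization a derivative lowers j by one, up to sign. For j = 0 it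
    is the Dirichlet kernel minus 1. *)
Definition cos_sum (j M : nat) (x : R) : R :=
  Rsum (fun k => 2 * cos (freq k * x) / freq k ^ j) M.

Definition sin_sum (j M : nat) (x : R) : R :=
  Rsum (fun k => 2 * sin (freq k * x) / freq k ^ j) M.

Lemma freq_lower (k : nat) : 2 * INR (S k) <= freq k.
Proof.
  unfold freq. assert (H := PI2_1). assert (0 <= INR (S k)) by apply pos_INR. nra.
Qed.

Lemma freq_pos (k : nat) : 0 < freq k.
Proof.
  assert (H := freq_lower k). rewrite S_INR in H. assert (Hk := pos_INR k). lra.
Qed.

Lemma is_derive_cos_sum (j M : nat) (x : R) :
  is_derive (cos_sum (S j) M) x (- sin_sum j M x).
Proof.
  unfold sin_sum.
  replace (- Rsum (fun k => 2 * sin (freq k * x) / freq k ^ j) M)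
    with (Rsum (fun k => -1 * (2 * sin (freq k * x) / freq k ^ j)) M)
    by (rewrite Rsum_scal; ring).
  apply (is_derive_Rsum (fun k x => 2 * cos (freq k * x) / freq k ^ S j)
           (fun k x => -1 * (2 * sin (freq k * x) / freq k ^ j))).
  intros k. assert (Hk := freq_pos k). assert (freq k ^ j <> 0) by (apply pow_nonzero; lra).
  auto_derive; [trivial|]. simpl pow. field. split; lra.
Qed.

Lemma is_derive_sin_sum (j M : nat) (x : R) :
  is_derive (sin_sum (S j) M) x (cos_sum j M x).
Proof.
  apply (is_derive_Rsum (fun k x => 2 * sin (freq k * x) / freq k ^ S j)
           (fun k x => 2 * cos (freq k * x) / freq k ^ j)).
  intros k. assert (Hk := freq_pos k). assert (freq k ^ j <> 0) by (apply pow_nonzero; lra).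
  auto_derive; [trivial|]. simpl pow. field. split; lra.
Qed.

Lemma trig_term_bound (t : R) (j k : nat) :
  (2 <= j)%nat -> Rabs t <= 1 -> Rabs (2 * t / freq k ^ j) <= / (INR k + 1) ^ 2.
Proof.
  intros Hj Ht. assert (Hf := freq_lower k). rewrite S_INR in Hf. assert (Hk := pos_INR k).
  assert (Hp : freq k ^ 2 <= freq k ^ j) by (apply Rle_pow; [lra|lia]).
  assert (H2 : 2 * (INR k + 1) ^ 2 <= freq k ^ j) by nra.
  assert (H0 : 0 < (INR k + 1) ^ 2) by nra.
  unfold Rdiv. rewrite !Rabs_mult, (Rabs_pos_eq 2), Rabs_inv, (Rabs_pos_eq (freq k ^ j)) by lra.
  apply Rle_trans with (2 * 1 * / (2 * (INR k + 1) ^ 2)).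
  - apply Rmult_le_compat; [assert (H := Rabs_pos t); lra| |lra|].
    + left; apply Rinv_0_lt_compat; lra.
    + apply Rinv_le_contravar; lra.
  - right; field; lra.
Qed.

Lemma cos_sum_tail (M p : nat) (x : R) :
  (1 <= M)%nat -> Rabs (cos_sum 2 (M + p) x - cos_sum 2 M x) <= / INR M.
Proof.
  intros HM. unfold cos_sum. rewrite Rsum_add.
  match goal with |- Rabs (?a + ?b - ?a) <= _ => replace (a + b - a) with b by ring end.
  assert (1 <= INR M) by (apply (le_INR 1); lia).
  apply Rle_trans with (Rsum (fun k => / (INR k + (INR M + 1)) ^ 2) p).
  - apply Rsum_abs_le. intros k.
    replace (INR k + (INR M + 1)) with (INR (M + k) + 1) by (rewrite plus_INR; ring).
    apply trig_term_bound; [lia|]. apply Rabs_le, COS_bound.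
  - replace (/ INR M) with (/ ((INR M + 1) - 1)) by (f_equal; ring).
    apply Rsum_inv_sq_le; lra.
Qed.

Lemma sin_sum_bound (j M : nat) (x : R) : (2 <= j)%nat -> Rabs (sin_sum j M x) <= 2.
Proof.
  intros Hj. unfold sin_sum. destruct M as [|M]; [simpl; rewrite Rabs_R0; lra|].
  apply Rle_trans with (Rsum (fun k => / (INR k + 1) ^ 2) (S M)).
  - apply Rsum_abs_le. intros k. apply trig_term_bound; [lia|]. apply Rabs_le, SIN_bound.
  (* The first term is split off because [Rsum_inv_sq_le] needs 1 < p; it contributes 1 and the rest
     at most 1/(2-1). *)
  - change (S M) with (1 + M)%nat. rewrite Rsum_add. cbn [Rsum].
    assert (H := Rsum_inv_sq_le 2 M).
    rewrite (Rsum_ext _ (fun k => / (INR k + 2) ^ 2)).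
    + replace (/ (2 - 1)) with 1 in H by field. simpl in *. lra.
    + intros k. change (1 + k)%nat with (S k). rewrite S_INR. do 2 f_equal. ring.
Qed.

Lemma dirichlet_kernel (M : nat) (x : R) :
  (1 + cos_sum 0 M x) * sin (PI * x) = sin ((2 * INR M + 1) * (PI * x)).
Proof.
  induction M as [|M IH].
  - unfold cos_sum; simpl. rewrite Rplus_0_r, Rmult_1_l. f_equal; ring.
  - unfold cos_sum in *; cbn [Rsum]. rewrite <- Rplus_assoc, Rmult_plus_distr_r, IH.
    simpl pow. unfold freq. rewrite S_INR.
    replace ((2 * (INR M + 1) + 1) * (PI * x)) with (2 * PI * (INR M + 1) * x + PI * x) by ring.
    replace ((2 * INR M + 1) * (PI * x)) with (2 * PI * (INR M + 1) * x - PI * x) by ring.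
    rewrite sin_plus, sin_minus. field.
Qed.

Lemma sin_PI_ge (h x : R) : 0 < h <= 1/2 -> h <= x <= 1 - h -> sin (PI * h) <= sin (PI * x).
Proof.
  intros Hh Hx. assert (HP := PI_RGT_0).
  destruct (Rle_dec x (1/2)) as [H|H].
  - apply sin_incr_1; nra.
  - rewrite <- (sin_PI_x (PI * x)). apply sin_incr_1; nra.
Qed.

(* Integrating the Dirichlet kernel by parts once: the boundary term
   [cos (n PI x) / (n PI sin (PI x))] has a derivative that cancels the kernel
   up to a term of size [1 / n]. *)
Lemma sawtooth_bound (h : R) :
  0 < h <= 1/2 -> exists B, forall M x, h <= x <= 1 - h ->
  Rabs (sin_sum 1 M x - (1/2 - x)) <= B / (2 * INR M + 1).
Proof.
  intros Hh. assert (HP := PI_RGT_0).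
  assert (Hs0 : 0 < sin (PI * h)).
  { apply sin_gt_0; nra. }
  set (m := sin (PI * h)) in *.
  (* The first summand bounds the boundary term [r]; the second bounds [g], by the mean value
     inequality from 1/2 on an interval of length at most 1. *)
  exists (/ (PI * m) + / m ^ 2). intros M x Hx.
  set (n := 2 * INR M + 1). assert (Hn : 1 <= n) by (unfold n; assert (H := pos_INR M); lra).
  set (r := fun t => cos (n * (PI * t)) / (n * PI * sin (PI * t))).
  set (g := fun t => sin_sum 1 M t - (1/2 - t) + r t).
  set (dg := fun t => - (cos (n * (PI * t)) * cos (PI * t) / (n * sin (PI * t) ^ 2))).
  assert (Hs : forall t, h <= t <= 1 - h -> m <= sin (PI * t)).
  { intros t Ht; apply sin_PI_ge; assumption. }
  assert (Hd : forall t, h <= t <= 1 - h -> is_derive g t (dg t)).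
  { intros t Ht. specialize (Hs t Ht). unfold g.
    replace (dg t) with ((cos_sum 0 M t + 1) + (dg t - (cos_sum 0 M t + 1))) by ring.
    apply (is_derive_plus (K := R_AbsRing) (V := R_NormedModule)).
    - replace (cos_sum 0 M t + 1) with (cos_sum 0 M t - (0 - 1)) by ring.
      apply (is_derive_minus (K := R_AbsRing) (V := R_NormedModule)).
      + apply is_derive_sin_sum.
      + auto_derive; [trivial|ring].
    - unfold r. auto_derive.
      + apply Rmult_integral_contrapositive_currified; [|lra].
        apply Rmult_integral_contrapositive_currified; lra.
      + unfold dg. assert (HD := dirichlet_kernel M t). fold n in HD.
        replace (cos_sum 0 M t + 1) with (sin (n * (PI * t)) / sin (PI * t)).
        * field. repeat split; lra.
        * rewrite <- HD. field. lra. }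
  assert (Hdb : forall t, h <= t <= 1 - h -> Rabs (dg t) <= / m ^ 2 / n).
  { intros t Ht. specialize (Hs t Ht). unfold dg, Rdiv.
    rewrite Rabs_Ropp, !Rabs_mult, Rabs_inv, Rabs_mult, (Rabs_pos_eq n) by lra.
    rewrite (Rabs_pos_eq (_ ^ 2)) by (apply pow2_ge_0).
    replace (/ m ^ 2 * / n) with (1 * 1 * / (n * m ^ 2)) by (field; lra).
    assert (A1 := Rabs_pos (cos (n * (PI * t)))). assert (A2 := Rabs_pos (cos (PI * t))).
    assert (B1 : Rabs (cos (n * (PI * t))) <= 1) by apply Rabs_le, COS_bound.
    assert (B2 : Rabs (cos (PI * t)) <= 1) by apply Rabs_le, COS_bound.
    assert (0 < n * m ^ 2) by nra.
    assert (n * m ^ 2 <= n * sin (PI * t) ^ 2).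
    { apply Rmult_le_compat_l; [lra|]. apply pow_incr; lra. }
    apply Rmult_le_compat; [nra| |nra|].
    - left; apply Rinv_0_lt_compat; lra.
    - apply Rinv_le_contravar; lra. }
  (* The point 1/2 anchors the estimate: every sine vanishes there, and so does the boundary term,
     since n is odd. *)
  assert (Hhalf : g (1/2) = 0).
  { unfold g, r, n, sin_sum.
    rewrite (Rsum_ext _ (fun k => 0 * 1)), Rsum_scal.
    - replace ((2 * INR M + 1) * (PI * (1/2))) with (INR M * PI + PI / 2) by field.
      rewrite cos_plus, cos_PI2, sin_PI2.
      replace (sin (INR M * PI)) with 0.
      + unfold Rdiv. ring.
      + clear. induction M as [|M IH]; [simpl; rewrite Rmult_0_l, sin_0; reflexivity|].
        rewrite S_INR, Rmult_plus_distr_r, Rmult_1_l, neg_sin, <- IH. ring.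
    - intros k. unfold freq.
      replace (2 * PI * INR (S k) * (1 / 2)) with (0 + INR (S k) * PI) by field.
      assert (H : forall i, sin (0 + INR i * PI) = 0).
      { clear. induction i as [|i IH]; [simpl; rewrite Rmult_0_l, Rplus_0_r; apply sin_0|].
        rewrite S_INR, Rmult_plus_distr_r, Rmult_1_l, <- Rplus_assoc, neg_sin, IH. ring. }
      rewrite H. unfold Rdiv. ring. }
  assert (Hg : Rabs (g x) <= / m ^ 2 / n).
  { assert (Hpos : 0 < / m ^ 2 / n).
    { apply Rdiv_lt_0_compat; [apply Rinv_0_lt_compat; nra|lra]. }
    destruct (Rle_dec x (1/2)) as [Hle|Hgt].
    - assert (H := mean_value_bound g dg x (1/2) (/ m ^ 2 / n)).
      rewrite Hhalf in H. rewrite <- Rabs_Ropp. replace (- g x) with (0 - g x) by ring.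
      eapply Rle_trans; [apply H|]; [lra| | |nra]; intros t Ht; [apply Hd|apply Hdb]; lra.
    - assert (H := mean_value_bound g dg (1/2) x (/ m ^ 2 / n)).
      rewrite Hhalf in H. replace (g x) with (g x - 0) by ring.
      eapply Rle_trans; [apply H|]; [lra| | |nra]; intros t Ht; [apply Hd|apply Hdb]; lra. }
  assert (Hr : Rabs (r x) <= / (PI * m) / n).
  { specialize (Hs x Hx). unfold r, Rdiv. rewrite Rabs_mult, Rabs_inv.
    rewrite (Rabs_pos_eq (n * PI * sin (PI * x))) by (apply Rmult_le_pos; nra).
    replace (/ (PI * m) * / n) with (1 * / (n * PI * m)) by (field; lra).
    apply Rmult_le_compat; [apply Rabs_pos| |apply Rabs_le, COS_bound|].
    - left; apply Rinv_0_lt_compat. apply Rmult_lt_0_compat; nra.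
    - apply Rinv_le_contravar; [apply Rmult_lt_0_compat; nra|].
      apply Rmult_le_compat_l; nra. }
  replace (sin_sum 1 M x - (1/2 - x)) with (g x + - r x) by (unfold g; ring).
  eapply Rle_trans; [apply Rabs_triang|]. rewrite Rabs_Ropp.
  unfold Rdiv in *. lra.
Qed.

Lemma INR_eventually_large (A : R) : exists p, A <= INR p.
Proof. destruct (nfloor_ex (Rmax 0 A)) as [p Hp]; [apply Rmax_l|].
  exists (S p). rewrite S_INR. assert (H := Rmax_r 0 A). lra. Qed.

(* [x^2 - x] plus a constant is [B_2]: this is its Fourier series, with the
   constant term eliminated by comparison with [x = 0]. *)
Lemma cos_sum_bernoulli (M : nat) (x : R) :
  (1 <= M)%nat -> 0 < x < 1 ->
  Rabs (cos_sum 2 M x - cos_sum 2 M 0 - (x ^ 2 - x) / 2) <= 2 / INR M.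
Proof.
  intros HM Hx. assert (HM1 : 1 <= INR M) by (apply (le_INR 1); lia).
  set (g := fun N t => cos_sum 2 N t - (t ^ 2 - t) / 2).
  assert (Hd : forall N t, is_derive (g N) t (- (sin_sum 1 N t - (1/2 - t)))).
  { intros N t. unfold g.
    replace (- (sin_sum 1 N t - (1/2 - t))) with (- sin_sum 1 N t - (t - 1/2)) by ring.
    apply (is_derive_minus (K := R_AbsRing) (V := R_NormedModule)).
    - apply is_derive_cos_sum.
    - auto_derive; [trivial|field]. }
  (* On [h, 1-h] the derivative of [g N] tends to 0 uniformly, so [g N] is nearly constant there for
     large N. Returning from N to M costs one tail 1/M at x and one at h. *)
  assert (Hin : forall h, 0 < h <= 1/2 -> h <= x <= 1 - h -> Rabs (g M x - g M h) <= 2 / INR M).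
  { intros h Hh Hxh. apply le_epsilon. intros eps Heps.
    destruct (sawtooth_bound h Hh) as [B HB].
    destruct (INR_eventually_large (B / eps)) as [p Hp].
    set (N := (M + p)%nat).
    assert (HN : Rabs (g N x - g N h) <= B / (2 * INR N + 1) * (x - h)).
    { apply (mean_value_bound (g N) (fun t => - (sin_sum 1 N t - (1/2 - t)))); [lra| |].
      - intros t _; apply Hd.
      - intros t Ht. rewrite Rabs_Ropp. apply HB; lra. }
    assert (HNp : INR N = INR M + INR p) by apply plus_INR.
    assert (Hp0 := pos_INR p).
    assert (HBe : B / (2 * INR N + 1) <= eps).
    { apply Rle_div_l; [lra|]. apply Rle_div_l in Hp; [|lra]. nra. }
    assert (HB0 : 0 <= B / (2 * INR N + 1)).
    { eapply Rle_trans; [apply Rabs_pos|apply (HB N x Hxh)]. }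
    assert (T1 := cos_sum_tail M p x HM). assert (T2 := cos_sum_tail M p h HM). fold N in T1, T2.
    replace (g M x - g M h) with
      ((g N x - g N h) + ((cos_sum 2 N h - cos_sum 2 M h) + - (cos_sum 2 N x - cos_sum 2 M x)))
      by (unfold g; ring).
    eapply Rle_trans; [apply Rabs_triang|].
    eapply Rle_trans; [apply Rplus_le_compat_l, Rabs_triang|]. rewrite Rabs_Ropp.
    unfold Rdiv at 1. nra. }
  apply le_epsilon. intros eps Heps.
  (* The bound [Hin] does not depend on h, so h may go to 0 by continuity of [g M] for this fixed
     M. *)
  assert (Hc : continuous (g M) 0).
  { apply (ex_derive_continuous (K := R_AbsRing) (V := R_NormedModule)). eexists. apply Hd. }
  destruct (proj1 (filterlim_locally _ _) Hc (mkposreal eps Heps)) as [d Hdel].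
  set (h := Rmin (d / 2) (Rmin x (1 - x) / 2)).
  assert (Hd0 := cond_pos d).
  assert (Hh0 : 0 < Rmin x (1 - x)) by (apply Rmin_pos; lra).
  assert (Hhx : Rmin x (1 - x) <= x) by apply Rmin_l.
  assert (Hhx' : Rmin x (1 - x) <= 1 - x) by apply Rmin_r.
  assert (H1 : h <= d / 2) by apply Rmin_l.
  assert (H2 : h <= Rmin x (1 - x) / 2) by apply Rmin_r.
  assert (H3 : 0 < h) by (apply Rmin_pos; lra).
  assert (Hb : Rabs (g M h - g M 0) < eps).
  { apply (Hdel h). unfold ball; simpl; unfold AbsRing_ball, abs, minus, plus, opp; simpl.
    replace (h + - 0) with h by ring. rewrite Rabs_pos_eq; lra. }
  replace (cos_sum 2 M x - cos_sum 2 M 0 - (x ^ 2 - x) / 2)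
    with ((g M x - g M h) + (g M h - g M 0)) by (unfold g; field).
  eapply Rle_trans; [apply Rabs_triang|].
  assert (H := Hin h). lra.
Qed.

(** * Limits and derivatives of complex-valued functions *)

Fixpoint Csum (u : nat -> C) (n : nat) : C :=
  match n with O => RtoC 0 | S n => (Csum u n + u n)%C end.

Lemma sum_n_Csum (u : nat -> C) (n : nat) :
  sum_n (G := C_AbelianMonoid) u n = Csum u (S n).
Proof.
  induction n as [|n IH].
  - rewrite sum_O. simpl. ring.
  - rewrite sum_Sn, IH. reflexivity.
Qed.

Lemma Csum_ext (u v : nat -> C) (n : nat) :
  (forall k, u k = v k) -> Csum u n = Csum v n.
Proof. intros H; induction n as [|n IH]; simpl; [|rewrite IH, H]; reflexivity. Qed.

Lemma Csum_minus (u v : nat -> C) (n : nat) :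
  Csum (fun k => u k - v k)%C n = (Csum u n - Csum v n)%C.
Proof. induction n as [|n IH]; simpl; [|rewrite IH]; ring. Qed.

Lemma Csum_S_l (u : nat -> C) (n : nat) :
  Csum u (S n) = (u O + Csum (fun k => u (S k)) n)%C.
Proof.
  induction n as [|n IH]; [simpl; ring|].
  change (Csum u (S (S n))) with (Csum u (S n) + u (S n))%C. rewrite IH. simpl. ring.
Qed.

Lemma Csum_telescope (u : nat -> C) (n : nat) :
  Csum (fun k => u k - u (S k))%C n = (u O - u n)%C.
Proof. induction n as [|n IH]; simpl; [|rewrite IH]; ring. Qed.

Lemma Cmod_Csum_le (u : nat -> C) (v : nat -> R) (n : nat) :
  (forall k, Cmod (u k) <= v k) -> Cmod (Csum u n) <= Rsum v n.
Proof.
  intros H; induction n as [|n IH]; simpl; [rewrite Cmod_0; lra|].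
  eapply Rle_trans; [apply Cmod_triangle|]. specialize (H n). lra.
Qed.

Lemma Cmod_minus_sym (x y : C) : Cmod (x - y) = Cmod (y - x).
Proof. rewrite <- Cmod_opp. f_equal. ring. Qed.

Lemma Cmod_le_components (z : C) : Cmod z <= Rabs (Re z) + Rabs (Im z).
Proof.
  destruct z as [x y]; simpl.
  replace (x, y) with (RtoC x + RtoC y * Ci)%C
    by (unfold RtoC, Ci, Cplus, Cmult; simpl; f_equal; ring).
  eapply Rle_trans; [apply Cmod_triangle|].
  rewrite Cmod_mult, Cmod_Ci, !Cmod_R. lra.
Qed.

Lemma im_le_Cmod (z : C) : Rabs (Im z) <= Cmod z.
Proof. eapply Rle_trans; [apply Rmax_r|apply Rmax_Cmod]. Qed.

(** Stated with the modulus rather than with the product balls of [C], so that estimates on [Cmod]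
    apply directly. It serves both for [eventually] and for s decreasing to 1. *)
Definition Ctends {T : Type} (F : (T -> Prop) -> Prop) (h : T -> C) (l : C) : Prop :=
  forall eps : R, 0 < eps -> F (fun t => Cmod (h t - l) < eps).

Section Limits.
Context {T : Type} {F : (T -> Prop) -> Prop} {FF : Filter F}.

Lemma Ctends_const (c : C) : Ctends F (fun _ => c) c.
Proof.
  intros eps Heps. apply filter_forall. intros _.
  replace (c - c)%C with (RtoC 0) by ring. rewrite Cmod_0; exact Heps.
Qed.

Lemma Ctends_ext_loc (g h : T -> C) (l : C) :
  F (fun t => g t = h t) -> Ctends F g l -> Ctends F h l.
Proof.
  intros He Hg eps Heps. generalize (filter_and _ _ He (Hg eps Heps)).
  apply filter_imp. intros t [<- Ht]; exact Ht.
Qed.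

Lemma Ctends_ext (g h : T -> C) (l : C) :
  (forall t, g t = h t) -> Ctends F g l -> Ctends F h l.
Proof. intros He. apply Ctends_ext_loc. apply filter_forall, He. Qed.

Lemma Ctends_plus (g h : T -> C) (a b : C) :
  Ctends F g a -> Ctends F h b -> Ctends F (fun t => g t + h t)%C (a + b)%C.
Proof.
  intros Hg Hh eps Heps. assert (He : 0 < eps / 2) by lra.
  generalize (filter_and _ _ (Hg _ He) (Hh _ He)).
  apply filter_imp. intros t [H1 H2].
  replace (g t + h t - (a + b))%C with ((g t - a) + (h t - b))%C by ring.
  eapply Rle_lt_trans; [apply Cmod_triangle|]. lra.
Qed.

Lemma Ctends_scal (c : C) (h : T -> C) (l : C) :
  Ctends F h l -> Ctends F (fun t => c * h t)%C (c * l)%C.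
Proof.
  intros Hh eps Heps. assert (Hc := Cmod_ge_0 c).
  assert (Hpos : 0 < eps / (Cmod c + 1)) by (apply Rdiv_lt_0_compat; lra).
  generalize (Hh _ Hpos). apply filter_imp. intros t Ht.
  replace (c * h t - c * l)%C with (c * (h t - l))%C by ring. rewrite Cmod_mult.
  apply Rle_lt_trans with (Cmod c * (eps / (Cmod c + 1))).
  - apply Rmult_le_compat_l; lra.
  - apply Rlt_le_trans with ((Cmod c + 1) * (eps / (Cmod c + 1))).
    + apply Rmult_lt_compat_r; lra.
    + right. field. lra.
Qed.

Lemma Ctends_minus (g h : T -> C) (a b : C) :
  Ctends F g a -> Ctends F h b -> Ctends F (fun t => g t - h t)%C (a - b)%C.
Proof.
  intros Hg Hh. apply (Ctends_scal (-1)) in Hh.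
  replace (a - b)%C with (a + -1 * b)%C by ring.
  eapply Ctends_ext; [|apply (Ctends_plus _ _ _ _ Hg Hh)]. intros t; simpl; ring.
Qed.

Lemma Ctends_Csum (h : nat -> T -> C) (l : nat -> C) (n : nat) :
  (forall k, Ctends F (h k) (l k)) ->
  Ctends F (fun t => Csum (fun k => h k t) n) (Csum l n).
Proof.
  intros H; induction n as [|n IH]; simpl; [apply Ctends_const|].
  apply Ctends_plus; [exact IH|apply H].
Qed.

Lemma Ctends_squeeze (h : T -> C) (r : T -> R) :
  F (fun t => Cmod (h t) <= r t) -> filterlim r F (locally 0) -> Ctends F h 0.
Proof.
  intros Hb Hr eps Heps.
  generalize (filter_and _ _ Hb (proj1 (filterlim_locally _ _) Hr (mkposreal eps Heps))).
  apply filter_imp. intros t [H1 H2].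
  replace (h t - 0)%C with (h t) by ring.
  unfold ball in H2; simpl in H2; unfold AbsRing_ball, abs, minus, plus, opp in H2; simpl in H2.
  replace (r t + - 0) with (r t) in H2 by ring.
  assert (H := Rle_abs (r t)). lra.
Qed.

End Limits.

Lemma Ctends_norm_le {T : Type} {F : (T -> Prop) -> Prop} {FF : ProperFilter F}
  (h : T -> C) (l : C) (B : R) :
  F (fun t => Cmod (h t) <= B) -> Ctends F h l -> Cmod l <= B.
Proof.
  intros Hb Hh. apply Rnot_lt_le. intros Hlt. apply Rlt_0_minus in Hlt.
  destruct (filter_ex _ (filter_and _ _ Hb (Hh _ Hlt))) as [t [H1 H2]].
  assert (Cmod l <= Cmod (h t) + Cmod (h t - l)).
  { replace l with (h t + - (h t - l))%C at 1 by ring.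
    eapply Rle_trans; [apply Cmod_triangle|]. rewrite Cmod_opp. lra. }
  lra.
Qed.

Lemma Ctends_unique {T : Type} {F : (T -> Prop) -> Prop} {FF : ProperFilter F}
  (h : T -> C) (a b : C) : Ctends F h a -> Ctends F h b -> a = b.
Proof.
  intros Ha Hb. assert (H := Ctends_minus _ _ _ _ Ha Hb).
  assert (H0 : Cmod (a - b) <= 0).
  { apply (Ctends_norm_le (F := F) (fun t => h t - h t)%C); [|exact H].
    apply filter_forall. intros t. replace (h t - h t)%C with (RtoC 0) by ring.
    rewrite Cmod_0; lra. }
  assert (H1 := Cmod_ge_0 (a - b)).
  assert (H2 : (a - b = 0)%C) by (apply Cmod_eq_0; lra).
  replace a with (a - b + b)%C by ring. rewrite H2. ring.
Qed.

Lemma Ctends_shift (h : nat -> C) (l : C) (p : nat) :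
  Ctends eventually h l -> Ctends eventually (fun n => h (n + p)%nat) l.
Proof.
  intros H eps Heps. destruct (H eps Heps) as [N HN]. exists N.
  intros n Hn. apply HN. lia.
Qed.

Lemma is_series_Ctends (u : nat -> C) (l : C) :
  is_series (V := C_NormedModule) u l -> Ctends eventually (Csum u) l.
Proof.
  intros H eps Heps.
  apply (filterlim_locally_ball_norm (K := C_AbsRing) (U := C_NormedModule))
    with (eps := mkposreal eps Heps) in H.
  destruct H as [N HN]. exists (S N). intros [|n] Hn; [lia|].
  rewrite <- sum_n_Csum. apply (HN n). lia.
Qed.

(** Derivative along a real variable, taken componentwise so that the real mean value theorem and
    [auto_derive] apply. It suffices because only horizontal rays x + b and real exponents s are
    ever followed. *)
Definition cderiv (g : R -> C) (x : R) (l : C) : Prop :=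
  is_derive (fun t => Re (g t)) x (Re l) /\ is_derive (fun t => Im (g t)) x (Im l).

Lemma cderiv_eq (g : R -> C) (x : R) (l l' : C) : cderiv g x l -> l = l' -> cderiv g x l'.
Proof. intros H <-; exact H. Qed.

Lemma cderiv_ext_loc (g h : R -> C) (x : R) (l : C) :
  locally x (fun t => g t = h t) -> cderiv g x l -> cderiv h x l.
Proof.
  intros He [H1 H2]; split; (eapply is_derive_ext_loc; [|eassumption]);
    revert He; apply filter_imp; intros t ->; reflexivity.
Qed.

Lemma cderiv_ext (g h : R -> C) (x : R) (l : C) :
  (forall t, g t = h t) -> cderiv g x l -> cderiv h x l.
Proof. intros He. apply cderiv_ext_loc. apply filter_forall, He. Qed.

Lemma cderiv_RtoC (r : R -> R) (x l : R) :
  is_derive r x l -> cderiv (fun t => RtoC (r t)) x (RtoC l).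
Proof. intros H; split; [exact H|exact (@is_derive_const R_AbsRing R_NormedModule 0 x)]. Qed.

Lemma cderiv_const (c : C) (x : R) : cderiv (fun _ => c) x 0.
Proof. split; exact (@is_derive_const R_AbsRing R_NormedModule _ x). Qed.

Lemma cderiv_plus (g h : R -> C) (x : R) (a b : C) :
  cderiv g x a -> cderiv h x b -> cderiv (fun t => g t + h t)%C x (a + b)%C.
Proof.
  intros [H1 H2] [H3 H4]; split;
    apply (is_derive_plus (K := R_AbsRing) (V := R_NormedModule)); assumption.
Qed.

Lemma cderiv_mult (g h : R -> C) (x : R) (a b : C) :
  cderiv g x a -> cderiv h x b -> cderiv (fun t => g t * h t)%C x (a * h x + g x * b)%C.
Proof.
  intros [H1 H2] [H3 H4].
  assert (M11 := is_derive_mult _ _ _ _ _ H1 H3 Rmult_comm).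
  assert (M12 := is_derive_mult _ _ _ _ _ H1 H4 Rmult_comm).
  assert (M21 := is_derive_mult _ _ _ _ _ H2 H3 Rmult_comm).
  assert (M22 := is_derive_mult _ _ _ _ _ H2 H4 Rmult_comm).
  split.
  - assert (M := is_derive_minus (K := R_AbsRing) (V := R_NormedModule) _ _ _ _ _ M11 M22).
    eapply is_derive_ext.
    2: { match type of M with is_derive _ _ ?l =>
           replace (Re (a * h x + g x * b)%C) with l; [exact M|] end.
         unfold minus, plus, opp, mult; simpl. unfold Re, Im. ring. }
    intros t. unfold minus, plus, opp, mult; simpl. unfold Re, Im; ring.
  - assert (M := is_derive_plus (K := R_AbsRing) (V := R_NormedModule) _ _ _ _ _ M12 M21).
    eapply is_derive_ext.
    2: { match type of M with is_derive _ _ ?l =>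
           replace (Im (a * h x + g x * b)%C) with l; [exact M|] end.
         unfold minus, plus, opp, mult; simpl. unfold Re, Im. ring. }
    intros t. unfold minus, plus, opp, mult; simpl. unfold Re, Im; ring.
Qed.

Lemma cderiv_scal (c : C) (g : R -> C) (x : R) (l : C) :
  cderiv g x l -> cderiv (fun t => c * g t)%C x (c * l)%C.
Proof.
  intros H. eapply cderiv_eq; [apply (cderiv_mult _ _ _ _ _ (cderiv_const c x) H)|].
  simpl; ring.
Qed.

Lemma cderiv_minus (g h : R -> C) (x : R) (a b : C) :
  cderiv g x a -> cderiv h x b -> cderiv (fun t => g t - h t)%C x (a - b)%C.
Proof.
  intros Hg Hh. apply (cderiv_scal (-1)) in Hh.
  eapply cderiv_ext; [|eapply cderiv_eq; [apply (cderiv_plus _ _ _ _ _ Hg Hh)|]].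
  - intros t; simpl; ring.
  - ring.
Qed.

Lemma cderiv_pow (g : R -> C) (x : R) (l : C) (n : nat) :
  cderiv g x l -> cderiv (fun t => g t ^ S n)%C x (INR (S n) * g x ^ n * l)%C.
Proof.
  intros H; induction n as [|n IH].
  - eapply cderiv_ext; [|eapply cderiv_eq; [exact H|]].
    + intros t; simpl; ring.
    + simpl; ring.
  - eapply cderiv_eq; [apply (cderiv_mult _ _ _ _ _ H IH)|].
    rewrite (S_INR (S n)), RtoC_plus. simpl. ring.
Qed.

Lemma Cmod2_pos (z : C) : z <> 0 -> 0 < Re z ^ 2 + Im z ^ 2.
Proof. intros H. rewrite <- Cmod2_alt. apply pow_lt, Cmod_gt_0, H. Qed.

Lemma cderiv_inv (g : R -> C) (x : R) (l : C) :
  g x <> 0 -> cderiv g x l -> cderiv (fun t => / g t)%C x (- l / (g x * g x))%C.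
Proof.
  intros Hne [H1 H2]. assert (Hp := Cmod2_pos _ Hne).
  (* The parts of 1/(u+iv) are u/(u^2+v^2) and -v/(u^2+v^2); exchanging u and v lets one real
     formula give both. *)
  assert (Hreal : forall (u v : R -> R) (a b : R),
    is_derive u x a -> is_derive v x b -> 0 < u x ^ 2 + v x ^ 2 ->
    is_derive (fun t => u t / (u t ^ 2 + v t ^ 2)) x
      ((a * (v x ^ 2 - u x ^ 2) - 2 * u x * v x * b) / (u x ^ 2 + v x ^ 2) ^ 2)).
  { intros u v a b Hu Hv Huv.
    assert (E1 : ex_derive u x) by (eexists; exact Hu).
    assert (E2 : ex_derive v x) by (eexists; exact Hv).
    auto_derive.
    - repeat split; try assumption. simpl in Huv. lra.
    - rewrite (is_derive_unique (fun t : R => u t) _ _ Hu), (is_derive_unique (fun t : R => v t) _ _ Hv). field. lra. }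
  assert (HR := Hreal _ _ _ _ H1 H2 Hp). rewrite Rplus_comm in Hp.
  assert (HI := is_derive_opp (K := R_AbsRing) (V := R_NormedModule) _ _ _ (Hreal _ _ _ _ H2 H1 Hp)).
  assert (HZ : (Re (g x) * Re (g x) - Im (g x) * Im (g x)) ^ 2 +
     (Re (g x) * Im (g x) + Im (g x) * Re (g x)) ^ 2 <> 0).
  { replace (_ + _) with ((Im (g x) ^ 2 + Re (g x) ^ 2) ^ 2) by ring. apply pow_nonzero. lra. }
  split.
  - eapply is_derive_ext; [|match type of HR with is_derive _ _ ?d =>
      replace (Re (- l / (g x * g x))%C) with d; [exact HR|] end].
    + intros t; reflexivity.
    + destruct l as [a b], (g x) as [u v].
      cbv [Re Im Cdiv Cinv Cmult Copp fst snd] in *. field. split; lra.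
  - eapply is_derive_ext; [|match type of HI with is_derive _ _ ?d =>
      replace (Im (- l / (g x * g x))%C) with d; [exact HI|] end].
    + intros t. change (- (Im (g t) / (Im (g t) ^ 2 + Re (g t) ^ 2)) =
        - Im (g t) / (Re (g t) ^ 2 + Im (g t) ^ 2)).
      rewrite (Rplus_comm (Im (g t) ^ 2)). unfold Rdiv. ring.
    + change opp with Ropp. destruct l as [a b], (g x) as [u v].
      cbv [Re Im Cdiv Cinv Cmult Copp fst snd] in *. unfold opp; simpl. field. split; lra.
Qed.

Lemma cderiv_Cexp (g : R -> C) (x : R) (l : C) :
  cderiv g x l -> cderiv (fun t => Cexp (g t)) x (l * Cexp (g x))%C.
Proof.
  intros [H1 H2].
  assert (Hreal : forall (u v : R -> R) (a b : R), is_derive u x a -> is_derive v x b ->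
    is_derive (fun t => exp (u t) * cos (v t)) x
      (a * (exp (u x) * cos (v x)) - b * (exp (u x) * sin (v x))) /\
    is_derive (fun t => exp (u t) * sin (v t)) x
      (a * (exp (u x) * sin (v x)) + b * (exp (u x) * cos (v x)))).
  { intros u v a b Hu Hv.
    assert (E1 : ex_derive u x) by (eexists; exact Hu).
    assert (E2 : ex_derive v x) by (eexists; exact Hv).
    split; (auto_derive; [repeat split; assumption|]);
      rewrite (is_derive_unique (fun t : R => u t) _ _ Hu), (is_derive_unique (fun t : R => v t) _ _ Hv); ring. }
  exact (Hreal _ _ _ _ H1 H2).
Qed.

(** The factor 2 is the price of treating the real and imaginary parts separately, each with its own
    intermediate point. *)
Lemma complex_mean_value_bound (g dg : R -> C) (a b B : R) :
  a <= b ->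
  (forall x, a <= x <= b -> cderiv g x (dg x)) ->
  (forall x, a < x < b -> Cmod (dg x) <= B) ->
  Cmod (g b - g a) <= 2 * B * (b - a).
Proof.
  intros Hab Hd HB.
  eapply Rle_trans; [apply Cmod_le_components|].
  assert (H1 : Rabs (Re (g b) - Re (g a)) <= B * (b - a)).
  { apply (mean_value_bound (fun t => Re (g t)) (fun t => Re (dg t))); [exact Hab| |].
    - intros x Hx; apply Hd, Hx.
    - intros x Hx. eapply Rle_trans; [apply re_le_Cmod|apply HB, Hx]. }
  assert (H2 : Rabs (Im (g b) - Im (g a)) <= B * (b - a)).
  { apply (mean_value_bound (fun t => Im (g t)) (fun t => Im (dg t))); [exact Hab| |].
    - intros x Hx; apply Hd, Hx.
    - intros x Hx. eapply Rle_trans; [apply im_le_Cmod|apply HB, Hx]. }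
  unfold Rminus in H1, H2.
  change (Re (g b - g a)%C) with (Re (g b) + - Re (g a)).
  change (Im (g b - g a)%C) with (Im (g b) + - Im (g a)). lra.
Qed.

Lemma cderiv_quotient_at_right (g : R -> C) (x : R) (l : C) :
  cderiv g x l -> Ctends (at_right x) (fun s => (g s - g x) / RtoC (s - x))%C l.
Proof.
  intros [H1 H2] eps Heps.
  apply is_derive_Reals in H1; apply is_derive_Reals in H2.
  assert (He : 0 < eps / 2) by lra.
  destruct (H1 _ He) as [d1 Hd1]. destruct (H2 _ He) as [d2 Hd2].
  exists (mkposreal _ (Rmin_pos _ _ (cond_pos d1) (cond_pos d2))).
  intros s Hs Hxs.
  unfold ball in Hs; simpl in Hs; unfold AbsRing_ball, abs, minus, plus, opp in Hs; simpl in Hs.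
  assert (M1 := Rmin_l d1 d2). assert (M2 := Rmin_r d1 d2).
  assert (Hne : s - x <> 0) by lra.
  assert (Hsd1 : Rabs (s - x) < d1) by (unfold Rminus; lra).
  assert (Hsd2 : Rabs (s - x) < d2) by (unfold Rminus; lra).
  specialize (Hd1 _ Hne Hsd1). specialize (Hd2 _ Hne Hsd2).
  assert (Hsx : forall s : R, x + (s - x) = s) by (intros; ring).
  rewrite Hsx in Hd1, Hd2.
  eapply Rle_lt_trans; [apply Cmod_le_components|].
  unfold Cdiv. rewrite <- RtoC_inv by lra.
  replace (Re ((g s - g x) * RtoC (/ (s - x)) - l)%C)
    with ((Re (g s) - Re (g x)) / (s - x) - Re l)
    by (unfold Cminus, Cplus, Copp, Cmult, RtoC, Re, Im; simpl; unfold Rdiv; ring).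
  replace (Im ((g s - g x) * RtoC (/ (s - x)) - l)%C)
    with ((Im (g s) - Im (g x)) / (s - x) - Im l)
    by (unfold Cminus, Cplus, Copp, Cmult, RtoC, Re, Im; simpl; unfold Rdiv; ring).
  lra.
Qed.

Lemma cderiv_at_right (g : R -> C) (x : R) (l : C) :
  cderiv g x l -> Ctends (at_right x) g (g x).
Proof.
  intros H eps Heps.
  assert (Hl := Cmod_ge_0 l).
  assert (Hp : 0 < eps / (Cmod l + 1)) by (apply Rdiv_lt_0_compat; lra).
  generalize (cderiv_quotient_at_right g x l H 1 Rlt_0_1).
  assert (Hn : at_right x (fun s => x < s < x + eps / (Cmod l + 1))).
  { exists (mkposreal _ Hp). intros s Hs Hxs.
    unfold ball in Hs; simpl in Hs; unfold AbsRing_ball, abs, minus, plus, opp in Hs; simpl in Hs.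
    apply Rabs_def2 in Hs. lra. }
  intros Hq. generalize (filter_and _ _ Hq Hn). apply filter_imp.
  intros s [Hs1 Hs2].
  assert (Hne : RtoC (s - x) <> 0) by (intros E; apply RtoC_inj in E; lra).
  replace (g s - g x)%C with (RtoC (s - x) * ((g s - g x) / RtoC (s - x)))%C by (field; exact Hne).
  rewrite Cmod_mult, Cmod_R, Rabs_pos_eq by lra.
  assert (Hb : Cmod ((g s - g x) / RtoC (s - x)) <= Cmod l + 1).
  { replace ((g s - g x) / RtoC (s - x))%C with (((g s - g x) / RtoC (s - x) - l) + l)%C by ring.
    eapply Rle_trans; [apply Cmod_triangle|]. lra. }
  replace eps with (eps / (Cmod l + 1) * (Cmod l + 1)) by (field; lra).
  apply Rle_lt_trans with ((s - x) * (Cmod l + 1)); [apply Rmult_le_compat_l; lra|].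
  apply Rmult_lt_compat_r; lra.
Qed.

(** * Complex logarithm and the Euler-Maclaurin formula *)

Lemma Re_pos_neq_0 (z : C) : 0 < Re z -> z <> 0.
Proof. intros H ->. simpl in H. lra. Qed.

Lemma Cmod_pos (z : C) : 0 < Re z -> 0 < Cmod z.
Proof. intros H. apply Cmod_gt_0, Re_pos_neq_0, H. Qed.

Lemma Cexp_plus (z w : C) : Cexp (z + w) = (Cexp z * Cexp w)%C.
Proof.
  destruct z as [x y], w as [x' y']. unfold Cexp, Cmult. simpl. rewrite exp_plus, cos_plus, sin_plus. f_equal; ring.
Qed.

Lemma Cexp_0 : Cexp 0 = 1.
Proof. unfold Cexp; simpl. rewrite exp_0, cos_0, sin_0. unfold RtoC. f_equal; ring. Qed.

Lemma Cexp_opp (z : C) : Cexp (- z) = (/ Cexp z)%C.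
Proof.
  assert (H : (Cexp z * Cexp (- z) = 1)%C).
  { rewrite <- Cexp_plus. replace (z + - z)%C with (RtoC 0) by ring. apply Cexp_0. }
  assert (Hne : Cexp z <> 0).
  { intros E. rewrite E, Cmult_0_l in H. apply RtoC_inj in H. lra. }
  replace (Cexp (- z)) with (/ Cexp z * (Cexp z * Cexp (- z)))%C by (field; exact Hne).
  rewrite H. ring.
Qed.

Lemma Cmod_Cexp (z : C) : Cmod (Cexp z) = exp (Re z).
Proof.
  assert (He := exp_pos (Re z)).
  transitivity (sqrt (Rsqr (exp (Re z)))); [|apply sqrt_Rsqr; lra].
  unfold Cmod, Cexp; cbn [fst snd]. f_equal.
  assert (H := sin2_cos2 (Im z)).
  replace (_ + _) with (Rsqr (exp (Re z)) * (Rsqr (sin (Im z)) + Rsqr (cos (Im z))))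
    by (unfold Rsqr; ring).
  rewrite H. ring.
Qed.

Lemma sqrt_1_minus_cos_sq (z : C) :
  z <> 0 -> sqrt (1 - (Re z / Cmod z)²) = Rabs (Im z) / Cmod z.
Proof.
  intros H. apply Cmod_gt_0 in H. assert (H2 := Cmod2_alt z).
  rewrite <- (sqrt_Rsqr (Rabs (Im z) / Cmod z)).
  - f_equal. rewrite !Rsqr_div', <- Rsqr_abs. unfold Rsqr.
    replace (Im z * Im z) with (Cmod z * Cmod z - Re z * Re z) by (simpl in H2; lra).
    field. lra.
  - apply Rdiv_le_0_compat; [apply Rabs_pos|exact H].
Qed.

Lemma Re_div_Cmod_bound (z : C) : z <> 0 -> -1 <= Re z / Cmod z <= 1.
Proof.
  intros H. apply Cmod_gt_0 in H. assert (HR := re_le_Cmod z).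
  apply Rabs_le_between in HR. split; [apply Rle_div_r|apply Rle_div_l]; lra.
Qed.

Lemma Cexp_Clog (z : C) : z <> 0 -> Cexp (Clog z) = z.
Proof.
  intros H. assert (Hb := Re_div_Cmod_bound z H). assert (Hs := sqrt_1_minus_cos_sq z H).
  assert (Hm := proj1 (Cmod_gt_0 z) H).
  unfold Cexp, Clog; cbn [Re Im fst snd]. rewrite exp_ln by exact Hm.
  assert (Hc : cos (Carg z) = Re z / Cmod z /\ sin (Carg z) = Im z / Cmod z).
  { unfold Carg. destruct (Rle_dec 0 (Im z)) as [Hi|Hi].
    - rewrite cos_acos, sin_acos, Hs by exact Hb. rewrite Rabs_pos_eq by exact Hi. split; reflexivity.
    - rewrite cos_neg, sin_neg, cos_acos, sin_acos, Hs by exact Hb.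
      rewrite Rabs_left by lra. split; [reflexivity|]. field. lra. }
  destruct Hc as [-> ->]. destruct z as [x y]. cbn [Re Im fst snd]. f_equal; field; lra.
Qed.

(** In the right half-plane the two arccosine branches merge into one formula that is smooth across
    the real axis, which makes [Clog] differentiable there. *)
Lemma Carg_atan (z : C) : 0 < Re z -> Carg z = atan (Im z / Re z).
Proof.
  intros H. assert (Hm := Cmod_pos z H). unfold Carg.
  rewrite acos_atan by (apply Rdiv_lt_0_compat; assumption).
  rewrite sqrt_1_minus_cos_sq by (apply Re_pos_neq_0, H).
  replace (Rabs (Im z) / Cmod z / (Re z / Cmod z)) with (Rabs (Im z) / Re z) by (field; lra).
  destruct (Rle_dec 0 (Im z)) as [Hi|Hi].
  - rewrite Rabs_pos_eq by exact Hi. reflexivity.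
  - rewrite Rabs_left, <- atan_opp by lra. f_equal. field. lra.
Qed.

Lemma cderiv_shift (b : C) (x : R) : cderiv (fun t => RtoC t + b)%C x 1.
Proof.
  eapply cderiv_eq; [apply cderiv_plus; [apply cderiv_RtoC|apply cderiv_const]|].
  - apply (is_derive_id (K := R_AbsRing)).
  - change (1 + 0 = 1)%C. ring.
Qed.

Lemma Re_shift_pos (b : C) (x : R) : 0 < Re b -> 0 <= x -> 0 < Re (RtoC x + b).
Proof. intros Hb Hx. rewrite re_plus, re_RtoC. lra. Qed.

Lemma cderiv_Clog_shift (b : C) (x : R) :
  0 < Re b -> 0 <= x -> cderiv (fun t => Clog (RtoC t + b)) x (/ (RtoC x + b))%C.
Proof.
  intros Hb Hx. destruct b as [p q]. simpl in Hb.
  (* The radius p = Re b works for every x >= 0, so the derivative is two-sided even at the endpoint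
     0. *)
  assert (Hloc : locally x (fun t => 0 < Re (RtoC t + (p, q))%C)).
  { exists (mkposreal p Hb). intros t Ht.
    unfold ball in Ht; simpl in Ht; unfold AbsRing_ball, abs, minus, plus, opp in Ht; simpl in Ht.
    apply Rabs_def2 in Ht. simpl. lra. }
  assert (Hsq : 0 < (x + p) ^ 2 + q ^ 2) by nra.
  apply (cderiv_ext_loc (fun t => (ln (sqrt ((t + p) ^ 2 + q ^ 2)), atan (q / (t + p))))).
  { revert Hloc. apply filter_imp. intros t Ht. unfold Clog.
    rewrite Carg_atan by exact Ht. unfold Cmod; simpl.
    rewrite !(Rplus_0_l q). reflexivity. }
  assert (Hs := sqrt_lt_R0 _ Hsq).
  assert (Hss := sqrt_sqrt ((x + p) ^ 2 + q ^ 2)).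
  split.
  - change (is_derive (fun t : R => ln (sqrt ((t + p) ^ 2 + q ^ 2))) x ((x + p) / ((x + p) ^ 2 + (0 + q) ^ 2))).
    auto_derive.
    + simpl in Hsq, Hs. repeat split; try assumption; lra.
    + rewrite Rplus_0_l. simpl in Hss, Hs, Hsq. simpl pow.
      set (S := sqrt _) in *. rewrite <- Hss by lra. field. lra.
  - change (is_derive (fun t : R => atan (q / (t + p))) x (- (0 + q) / ((x + p) ^ 2 + (0 + q) ^ 2))).
    auto_derive; [lra|]. field. repeat split; nra.
Qed.

Lemma cderiv_inv_shift (b : C) (x : R) :
  0 < Re b -> 0 <= x ->
  cderiv (fun t => / (RtoC t + b))%C x (- (/ (RtoC x + b)) ^ 2)%C.
Proof.
  intros Hb Hx. assert (Hne : (RtoC x + b)%C <> 0) by (apply Re_pos_neq_0, Re_shift_pos; assumption).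
  eapply cderiv_eq; [apply cderiv_inv; [exact Hne|apply cderiv_shift]|].
  simpl. field. exact Hne.
Qed.

(** The j-th derivative of x -> 1/(x+b). *)
Definition inv_deriv (b : C) (j : nat) (x : R) : C :=
  ((-1) ^ j * INR (fact j) * (/ (RtoC x + b)) ^ S j)%C.

Lemma cderiv_inv_deriv (b : C) (j : nat) (x : R) :
  0 < Re b -> 0 <= x -> cderiv (inv_deriv b j) x (inv_deriv b (S j) x).
Proof.
  intros Hb Hx. unfold inv_deriv.
  eapply cderiv_eq; [apply cderiv_scal, cderiv_pow, cderiv_inv_shift; assumption|].
  change (fact (S j)) with (S j * fact j)%nat. rewrite mult_INR, RtoC_mult.
  change ((-1) ^ S j)%C with (-1 * (-1) ^ j)%C. simpl Cpow. ring.
Qed.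

Lemma Cmod_shift_ge (b : C) (x : R) : 0 < Re b -> 0 <= x -> Cmod b <= Cmod (RtoC x + b).
Proof.
  intros Hb Hx. apply sqrt_le_1_alt. destruct b as [p q]; simpl in *. nra.
Qed.

Lemma Cmod_inv_deriv_le (b : C) (j : nat) (x : R) :
  0 < Re b -> 0 <= x -> Cmod (inv_deriv b j x) <= INR (fact j) / Cmod b ^ S j.
Proof.
  intros Hb Hx. assert (Hm := Cmod_pos b Hb). assert (Hge := Cmod_shift_ge b x Hb Hx).
  unfold inv_deriv. rewrite !Cmod_mult, !Cmod_pow, !Cmod_R, Cmod_inv
    by (apply Re_pos_neq_0, Re_shift_pos; assumption).
  rewrite (Rabs_left (-1)) by lra. replace (- -1) with 1 by ring. rewrite pow1, Rmult_1_l.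
  rewrite Rabs_pos_eq by apply pos_INR. unfold Rdiv. apply Rmult_le_compat_l; [apply pos_INR|].
  rewrite pow_inv by lra. apply Rinv_le_contravar; [apply pow_lt, Hm|].
  apply pow_incr; lra.
Qed.

(* Successive integrations by parts against the trigonometric sums, stopped at order [2N+3]. *)
Lemma cderiv_trig_parts (d : nat -> R -> C) (M N : nat) (x : R) :
  (forall j, cderiv (d j) x (d (S j) x)) ->
  cderiv (fun t => Csum (fun n => (-1) ^ n *
             (RtoC (cos_sum (2 * n + 2) M t) * d (2 * n + 1)%nat t
              - RtoC (sin_sum (2 * n + 3) M t) * d (2 * n + 2)%nat t))%C (S N))
    x (- RtoC (sin_sum 1 M x) * d 1%nat x
       - (-1) ^ N * RtoC (sin_sum (2 * N + 3) M x) * d (2 * N + 3)%nat x)%C.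
Proof.
  intros Hd.
  assert (Hn : forall n, cderiv (fun t => (-1) ^ n *
             (RtoC (cos_sum (2 * n + 2) M t) * d (2 * n + 1)%nat t
              - RtoC (sin_sum (2 * n + 3) M t) * d (2 * n + 2)%nat t))%C x
          ((-1) ^ n * (- RtoC (sin_sum (2 * n + 1) M x) * d (2 * n + 1)%nat x
              - RtoC (sin_sum (2 * n + 3) M x) * d (2 * n + 3)%nat x))%C).
  { intros n. eapply cderiv_eq; [apply cderiv_scal, cderiv_minus; apply cderiv_mult|].
    - apply cderiv_RtoC. replace (2 * n + 2)%nat with (S (2 * n + 1)) by lia. apply is_derive_cos_sum.
    - apply Hd.
    - apply cderiv_RtoC. replace (2 * n + 3)%nat with (S (2 * n + 2)) by lia. apply is_derive_sin_sum.
    - apply Hd.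
    - replace (2 * n + 3)%nat with (S (2 * n + 2)) by lia.
      replace (S (2 * n + 1)) with (2 * n + 2)%nat by lia.
      rewrite RtoC_opp. ring. }
  (* Because of the alternating sign, the order 2n+3 term left by index n cancels the leading term
     of index n+1; only the two ends survive. *)
  induction N as [|N IH].
  - eapply cderiv_eq; [apply cderiv_plus; [apply cderiv_const|apply Hn]|]. simpl. ring.
  - eapply cderiv_eq; [apply cderiv_plus; [exact IH|apply Hn]|].
    replace (2 * S N + 1)%nat with (2 * N + 3)%nat by lia.
    change ((-1) ^ S N)%C with (-1 * (-1) ^ N)%C. ring.
Qed.

Lemma cos_freq (k : nat) : cos (freq k * 1) = 1.
Proof.
  unfold freq. replace (2 * PI * INR (S k) * 1) with (0 + 2 * INR (S k) * PI) by ring.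
  rewrite cos_period. apply cos_0.
Qed.

Lemma sin_freq (k : nat) : sin (freq k * 1) = 0.
Proof.
  unfold freq. replace (2 * PI * INR (S k) * 1) with (0 + 2 * INR (S k) * PI) by ring.
  rewrite sin_period. apply sin_0.
Qed.

Lemma cos_sum_1 (j M : nat) : cos_sum j M 1 = cos_sum j M 0.
Proof. apply Rsum_ext. intros k. rewrite cos_freq, Rmult_0_r, cos_0. reflexivity. Qed.

Lemma sin_sum_0 (j M : nat) : sin_sum j M 0 = 0.
Proof.
  unfold sin_sum. rewrite (Rsum_ext _ (fun _ => 0 * 0)), Rsum_scal; [ring|].
  intros k. rewrite Rmult_0_r, sin_0. unfold Rdiv; ring.
Qed.

Lemma sin_sum_1 (j M : nat) : sin_sum j M 1 = 0.
Proof.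
  unfold sin_sum. rewrite (Rsum_ext _ (fun _ => 0 * 0)), Rsum_scal; [ring|].
  intros k. rewrite sin_freq. unfold Rdiv; ring.
Qed.

(** The factor (-1)^n [cos_sum (2 * n + 2) M 0] stands for the coefficient B_(2n+2)/(2n+2)!, and
    [4 * B0 / INR M] is the cost of the truncation. In both constants, 4 is the 2 of the complex
    mean value bound times the 2 of [cos_sum_bernoulli] or of [sin_sum_bound]. *)
Lemma euler_maclaurin (F : R -> C) (d : nat -> R -> C) (M N : nat) (B0 B1 : R) :
  (1 <= M)%nat ->
  (forall x, 0 <= x <= 1 -> cderiv F x (d O x)) ->
  (forall j x, 0 <= x <= 1 -> cderiv (d j) x (d (S j) x)) ->
  (forall x, 0 <= x <= 1 -> Cmod (d 2%nat x) <= B0) ->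
  (forall x, 0 <= x <= 1 -> Cmod (d (2 * N + 3)%nat x) <= B1) ->
  Cmod ((d O 0 + d O 1) / 2 - (F 1%R - F 0%R)
    - Csum (fun n => (-1) ^ n * RtoC (cos_sum (2 * n + 2) M 0)
                     * (d (2 * n + 1)%nat 1%R - d (2 * n + 1)%nat 0%R))%C (S N))
  <= 4 * B0 / INR M + 4 * B1.
Proof.
  intros HM HF Hd H0 H1.
  assert (HM1 : 1 <= INR M) by (apply (le_INR 1); lia).
  set (e := fun t : R => cos_sum 2 M t - cos_sum 2 M 0 - (t ^ 2 - t) / 2).
  set (H := fun t => Csum (fun n => (-1) ^ n *
             (RtoC (cos_sum (2 * n + 2) M t) * d (2 * n + 1)%nat t
              - RtoC (sin_sum (2 * n + 3) M t) * d (2 * n + 2)%nat t))%C (S N)).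
  (* The first two terms of [G] have derivative (t-1/2) [d 1]. Adding [e] times [d 1] trades t-1/2
     for minus the truncated sawtooth, at the cost [e] times [d 2], and [H] absorbs that sawtooth.
     As [e] vanishes at 0 and 1, G(1) - G(0) is the Euler-Maclaurin error. *)
  set (G := fun t : R => (RtoC (t - 1/2) * d O t - F t + RtoC (e t) * d 1%nat t - H t)%C).
  set (dG := fun t : R => (RtoC (e t) * d 2%nat t
     + (-1) ^ N * RtoC (sin_sum (2 * N + 3) M t) * d (2 * N + 3)%nat t)%C).
  assert (He : forall t, is_derive e t (- sin_sum 1 M t - (t - 1/2))).
  { intros t. apply (is_derive_minus (K := R_AbsRing) (V := R_NormedModule)).
    - replace (- sin_sum 1 M t) with (- sin_sum 1 M t - 0) by ring.
      apply (is_derive_minus (K := R_AbsRing) (V := R_NormedModule)); [apply is_derive_cos_sum|].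
      exact (@is_derive_const R_AbsRing R_NormedModule _ t).
    - auto_derive; [trivial|field]. }
  assert (HG : forall t, 0 <= t <= 1 -> cderiv G t (dG t)).
  { intros t Ht. eapply cderiv_eq.
    - apply cderiv_minus; [apply cderiv_plus; [apply cderiv_minus|]|].
      + apply cderiv_mult; [apply cderiv_RtoC|apply Hd, Ht].
        apply (is_derive_minus (K := R_AbsRing) (V := R_NormedModule));
          [apply (is_derive_id (K := R_AbsRing))|exact (@is_derive_const R_AbsRing R_NormedModule _ t)].
      + apply HF, Ht.
      + apply cderiv_mult; [apply cderiv_RtoC, He|apply Hd, Ht].
      + apply cderiv_trig_parts. intros j; apply Hd, Ht.
    - unfold dG. change (minus one zero) with (1 - 0). rewrite !RtoC_minus, RtoC_opp. ring. }
  assert (HdG : forall t, 0 < t < 1 -> Cmod (dG t) <= 2 / INR M * B0 + 2 * B1).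
  { intros t Ht. unfold dG. eapply Rle_trans; [apply Cmod_triangle|].
    rewrite !Cmod_mult, Cmod_pow, !Cmod_R, (Rabs_left (-1)) by lra.
    replace (- -1) with 1 by ring. rewrite pow1, Rmult_1_l.
    apply Rplus_le_compat; apply Rmult_le_compat; try apply Rabs_pos; try apply Cmod_ge_0.
    - apply cos_sum_bernoulli; assumption.
    - apply H0; lra.
    - apply sin_sum_bound; lia.
    - apply H1; lra. }
  assert (Hb := complex_mean_value_bound G dG 0 1 _ Rle_0_1 HG HdG).
  replace (4 * B0 / INR M + 4 * B1) with (2 * (2 / INR M * B0 + 2 * B1) * (1 - 0)) by (field; lra).
  eapply Rle_trans; [right|exact Hb]. f_equal.
  assert (E0 : e 0 = 0) by (unfold e; field).
  assert (E1 : e 1 = 0) by (unfold e; rewrite cos_sum_1; field).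
  unfold G. rewrite E0, E1.
  assert (EH : (H 1%R - H 0%R = Csum (fun n => (-1) ^ n * RtoC (cos_sum (2 * n + 2) M 0)
                     * (d (2 * n + 1)%nat 1%R - d (2 * n + 1)%nat 0%R))%C (S N))%C).
  { unfold H. rewrite <- Csum_minus. apply Csum_ext. intros n.
    rewrite sin_sum_0, sin_sum_1, cos_sum_1. ring. }
  rewrite <- EH. replace (1 - 1 / 2) with (/ 2) by field. replace (0 - 1 / 2) with (- / 2) by field.
  rewrite RtoC_opp, RtoC_inv by lra. field.
Qed.

(** * The constant gamma_0 *)

Lemma pow_n_Cpow (z : C) (n : nat) : pow_n (K := C_AbsRing) z n = (z ^ n)%C.
Proof. induction n as [|n IH]; [reflexivity|]. simpl. rewrite IH. reflexivity. Qed.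

Lemma at_right_between (x d : R) : 0 < d -> at_right x (fun s => x < s < x + d).
Proof.
  intros Hd. exists (mkposreal d Hd). intros s Hs Hxs.
  unfold ball in Hs; simpl in Hs; unfold AbsRing_ball, abs, minus, plus, opp in Hs; simpl in Hs.
  apply Rabs_def2 in Hs. lra.
Qed.

Lemma Rsum_half_pow_le (n : nat) : Rsum (fun k => (1/2) ^ k) n <= 2.
Proof.
  assert (H : Rsum (fun k => (1/2) ^ k) n = 2 - 2 * (1/2) ^ n).
  { induction n as [|n IH]; simpl; [ring|]. rewrite IH. field. }
  assert (0 < (1/2) ^ n) by (apply pow_lt; lra). lra.
Qed.

(** Convergence at one point r forces the terms to 0, hence bounds them: Cauchy's estimate on the
    coefficients. *)
Lemma is_pseries_bound (c : nat -> C) (r : R) (l : C) :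
  0 < r -> is_pseries (K := C_AbsRing) (V := C_NormedModule) c (RtoC r) l ->
  exists B, 0 <= B /\ forall k, Cmod (c k) <= B / r ^ k.
Proof.
  intros Hr H. apply is_series_Ctends in H.
  set (u := fun k => scal (pow_n (K := C_AbsRing) (RtoC r) k) (c k) : C) in H.
  assert (Hu : Ctends eventually u 0).
  { replace (RtoC 0) with (l - l)%C by ring.
    eapply Ctends_ext; [|apply Ctends_minus; [apply (Ctends_shift _ _ 1 H)|exact H]].
    intros n. cbv beta. rewrite Nat.add_1_r. change (Csum u n + u n - Csum u n = u n)%C. ring. }
  destruct (Hu 1 Rlt_0_1) as [N HN].
  assert (Hfin : forall N, exists B, forall k, (k < N)%nat -> Cmod (u k) <= B).
  { induction N0 as [|n [B HB]]; [exists 0; lia|].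
    exists (Rmax B (Cmod (u n))). intros k Hk.
    destruct (Nat.eq_dec k n) as [->|Hne]; [apply Rmax_r|].
    eapply Rle_trans; [apply HB; lia|apply Rmax_l]. }
  destruct (Hfin N) as [B HB]. exists (Rmax B 1).
  split; [eapply Rle_trans; [apply Rle_0_1|apply Rmax_r]|]. intros k.
  assert (Hk : Cmod (u k) <= Rmax B 1).
  { destruct (Nat.lt_ge_cases k N) as [Hlt|Hge].
    - eapply Rle_trans; [apply HB, Hlt|apply Rmax_l].
    - assert (H1 := HN k Hge). replace (u k - 0)%C with (u k) in H1 by ring.
      eapply Rle_trans; [left; exact H1|apply Rmax_r]. }
  assert (Huk : u k = (RtoC r ^ k * c k)%C) by (unfold u; rewrite pow_n_Cpow; reflexivity).
  rewrite Huk, Cmod_mult, Cmod_pow, Cmod_R, Rabs_pos_eq in Hk by lra.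
  apply Rle_div_r; [apply pow_lt, Hr|]. lra.
Qed.

Lemma is_pseries_minus_head (c : nat -> C) (t r B : R) (l : C) :
  0 < r -> 0 < t <= r / 2 -> (forall k, Cmod (c k) <= B / r ^ k) ->
  is_pseries (K := C_AbsRing) (V := C_NormedModule) c (RtoC t) l ->
  Cmod (l - c O) <= 2 * B * t / r.
Proof.
  intros Hr Ht HB H. apply is_series_Ctends in H.
  assert (HB0 : 0 <= B).
  { specialize (HB O). simpl in HB. assert (H0 := Cmod_ge_0 (c O)). lra. }
  apply (Ctends_norm_le (F := eventually)
           (fun n => Csum (fun k => scal (pow_n (K := C_AbsRing) (RtoC t) k) (c k) : C) (n + 1) - c O)%C).
  2: { apply Ctends_minus; [apply (Ctends_shift _ _ 1 H)|apply Ctends_const]. }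
  apply filter_forall. intros n. rewrite Nat.add_1_r, Csum_S_l.
  replace (_ - c O)%C with
    (Csum (fun k => scal (pow_n (K := C_AbsRing) (RtoC t) (S k)) (c (S k)) : C) n)
    by (change (scal (pow_n (K := C_AbsRing) (RtoC t) 0) (c O)) with (1 * c O)%C; ring).
  assert (Hq : 0 < t / r) by (apply Rdiv_lt_0_compat; lra).
  assert (Hq2 : t / r <= 1 / 2) by (apply Rle_div_l; lra).
  apply Rle_trans with (Rsum (fun k => B * (t / r) * (1/2) ^ k) n).
  - apply Cmod_Csum_le. intros k. rewrite pow_n_Cpow.
    change (scal ?x ?y) with (Cmult x y).
    rewrite Cmod_mult, Cmod_pow, Cmod_R, Rabs_pos_eq by lra.
    apply Rle_trans with (t ^ S k * (B / r ^ S k)).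
    + apply Rmult_le_compat_l; [apply pow_le; lra|apply HB].
    + replace (t ^ S k * (B / r ^ S k)) with (B * (t / r) * (t / r) ^ k).
      * apply Rmult_le_compat_l; [nra|]. apply pow_incr; lra.
      * unfold Rdiv. rewrite Rpow_mult_distr, pow_inv by lra. simpl. field.
        split; [apply pow_nonzero|]; lra.
  - rewrite Rsum_scal. assert (H2 := Rsum_half_pow_le n).
    replace (2 * B * t / r) with (B * (t / r) * 2) by (field; lra).
    apply Rmult_le_compat_l; [apply Rmult_le_pos; lra|exact H2].
Qed.

(** The Laurent hypothesis only gives convergence at each point near 1. Coefficient bounds from one
    fixed radius r control the tail geometrically at all t <= r/2, which yields continuity at the
    centre. *)
Lemma stieltjes_0_limit (Z : C -> C) (g : nat -> C) :
  is_stieltjes Z g ->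
  Ctends (at_right 1) (fun s : R => Z (RtoC s) - 1 / (RtoC s - 1))%C (g O).
Proof.
  intros [e He]. assert (He0 := cond_pos e).
  set (r := e / 2). assert (Hr : 0 < r < e) by (unfold r; lra).
  assert (Hp : forall t, 0 < t < e ->
    is_pseries (K := C_AbsRing) (V := C_NormedModule)
      (fun n : nat => ((-1) ^ n / INR (fact n) * g n)%C) (RtoC t)
      (Z (RtoC (1 + t)) - 1 / (RtoC (1 + t) - 1))%C).
  { intros t Ht. replace (RtoC t) with (RtoC (1 + t) - 1)%C by (rewrite RtoC_plus; ring).
    apply He.
    - split; unfold ball; simpl; unfold AbsRing_ball, abs, minus, plus, opp; simpl.
      + replace (1 + t + -1) with t by ring. rewrite Rabs_pos_eq; lra.
      + rewrite Ropp_0, Rplus_0_r, Rabs_R0; lra.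
    - intros E. apply RtoC_inj in E. lra. }
  destruct (is_pseries_bound _ r _ (proj1 Hr) (Hp r Hr)) as [B [HB0 HB]].
  set (c := fun n : nat => ((-1) ^ n / INR (fact n) * g n)%C) in *.
  assert (Hc0 : c O = g O) by (unfold c; simpl; field).
  intros eps Heps.
  (* The second entry makes the tail bound 2Bt/r smaller than eps; the added 1 keeps the denominator
     positive when B = 0. *)
  assert (Hd : 0 < Rmin (r / 2) (eps * r / (2 * B + 1))).
  { apply Rmin_pos; [lra|]. apply Rdiv_lt_0_compat; [apply Rmult_lt_0_compat; lra|lra]. }
  generalize (at_right_between 1 _ Hd). apply filter_imp. intros s Hs.
  assert (M1 := Rmin_l (r / 2) (eps * r / (2 * B + 1))).
  assert (M2 := Rmin_r (r / 2) (eps * r / (2 * B + 1))).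
  assert (Hs1 : s - 1 < eps * r / (2 * B + 1)) by lra.
  assert (H := is_pseries_minus_head c (s - 1) r B
    (Z (RtoC (1 + (s - 1))) - 1 / (RtoC (1 + (s - 1)) - 1))%C).
  replace (1 + (s - 1)) with s in H by ring. rewrite Hc0 in H.
  eapply Rle_lt_trans; [apply H|].
  - lra.
  - lra.
  - exact HB.
  - replace s with (1 + (s - 1)) at 2 3 by ring. apply Hp. lra.
  - apply Rlt_div_r in Hs1; [|lra]. apply Rlt_div_l; [lra|]. nra.
Qed.

(** * The Hurwitz series as s decreases to 1 *)

Lemma hurwitz_tends (a : C) (Z : C -> C) (s : R) :
  is_hurwitz_zeta a Z -> 1 < s ->
  Ctends eventually (Csum (fun n => Cexp (- RtoC s * Clog (RtoC (INR n) + a)))%C) (Z (RtoC s)).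
Proof. intros [H _] Hs. apply is_series_Ctends. apply (H (RtoC s)). exact Hs. Qed.

Lemma cderiv_Cexp_scal (L : C) (x : R) :
  cderiv (fun s => Cexp (- RtoC s * L))%C x (- L * Cexp (- RtoC x * L))%C.
Proof.
  apply cderiv_Cexp. eapply cderiv_ext; [|eapply cderiv_eq].
  2: { apply (cderiv_scal (- L) RtoC x 1). apply cderiv_RtoC, (is_derive_id (K := R_AbsRing)). }
  - intros t. simpl. ring.
  - ring.
Qed.

(** For s > 1 the two series differ by the single term a^(-s). The poles cancel in the difference,
    and a^(-s) tends to 1/a. *)
Lemma stieltjes_0_shift (a : C) (Z Z' : C -> C) (g g' : nat -> C) :
  0 < Re a ->
  is_hurwitz_zeta a Z -> is_hurwitz_zeta (1 + a) Z' ->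
  is_stieltjes Z g -> is_stieltjes Z' g' ->
  (g O - g' O = / a)%C.
Proof.
  intros Ha HZ HZ' Hg Hg'. assert (Hne := Re_pos_neq_0 a Ha).
  apply stieltjes_0_limit in Hg; apply stieltjes_0_limit in Hg'.
  assert (H := Ctends_minus _ _ _ _ Hg Hg').
  apply (Ctends_unique (F := at_right 1) _ _ _ H).
  assert (Hl := cderiv_at_right _ 1 _ (cderiv_Cexp_scal (Clog a) 1)). cbv beta in Hl.
  replace (- RtoC 1 * Clog a)%C with (- Clog a)%C in Hl by ring.
  rewrite Cexp_opp, Cexp_Clog in Hl by exact Hne.
  eapply Ctends_ext_loc; [|exact Hl].
  generalize (at_right_between 1 1 Rlt_0_1). apply filter_imp. intros s Hs.
  assert (E : (Z (RtoC s) - Z' (RtoC s) = Cexp (- RtoC s * Clog a))%C).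
  { apply (Ctends_unique (F := eventually) (fun n =>
      Csum (fun n => Cexp (- RtoC s * Clog (RtoC (INR n) + a)))%C (n + 1)
      - Csum (fun n => Cexp (- RtoC s * Clog (RtoC (INR n) + (1 + a))))%C n)%C).
    - apply Ctends_minus; [apply (Ctends_shift _ _ 1)|]; apply hurwitz_tends; try assumption; lra.
    - eapply Ctends_ext; [|apply Ctends_const]. intros n. cbv beta.
      rewrite Nat.add_1_r, Csum_S_l. change (INR 0) with 0. rewrite Cplus_0_l.
      rewrite (Csum_ext _ (fun n => Cexp (- RtoC s * Clog (RtoC (INR n) + (1 + a))))%C); [ring|].
      intros k. cbv beta. rewrite S_INR, RtoC_plus. do 3 f_equal. ring. }
  rewrite <- E. ring.
Qed.

(** The quotient is the integral of (x+b)^(-s) over [0,1]; the point is a bound free of 1/(s-1). The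
    derivative of (x+b)^(-s) has modulus at most 2/r^2, where r >= 1 and s > 1 give |x+b|^(-s) <=
    1/r. Two mean value bounds with a factor 2 each give 8. *)
Lemma power_increment_bound (b : C) (r s : R) :
  1 <= r <= Re b -> 1 < s <= 2 ->
  Cmod (Cexp (- RtoC s * Clog b)
        - (Cexp ((1 - RtoC s) * Clog b) - Cexp ((1 - RtoC s) * Clog (1 + b))) / (RtoC s - 1))%C
  <= 8 * / r ^ 2.
Proof.
  intros Hr Hs. assert (Hb : 0 < Re b) by lra.
  assert (Hs1 : (RtoC s - 1)%C <> 0).
  { rewrite <- RtoC_minus. intros E; apply RtoC_inj in E; lra. }
  set (f := fun x => Cexp (- RtoC s * Clog (RtoC x + b))%C).
  assert (Hf : forall x, 0 <= x -> cderiv f x (- RtoC s * / (RtoC x + b) * f x)%C).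
  { intros x Hx. apply cderiv_Cexp, cderiv_scal, cderiv_Clog_shift; assumption. }
  assert (Hmod : forall x, 0 <= x -> r <= Cmod (RtoC x + b)).
  { intros x Hx. assert (H := re_le_Cmod (RtoC x + b)). assert (H2 := Rle_abs (Re (RtoC x + b))).
    rewrite re_plus, re_RtoC in H, H2. lra. }
  assert (Hfb : forall x, 0 <= x -> Cmod (f x) <= / r).
  { intros x Hx. specialize (Hmod x Hx). unfold f. rewrite Cmod_Cexp.
    apply Rle_trans with (/ Cmod (RtoC x + b)).
    - rewrite <- (exp_ln (/ Cmod (RtoC x + b))) by (apply Rinv_0_lt_compat; lra).
      rewrite ln_Rinv by lra.
      assert (Hln : 0 <= ln (Cmod (RtoC x + b))) by (rewrite <- ln_1; apply ln_le; lra).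
      assert (HE : Re (- RtoC s * Clog (RtoC x + b))%C = - s * ln (Cmod (RtoC x + b))).
      { rewrite re_mult. unfold Clog; simpl. ring. }
      rewrite HE. destruct (Req_dec (- s * ln (Cmod (RtoC x + b))) (- ln (Cmod (RtoC x + b)))) as [->|Hn]; [lra|].
      left; apply exp_increasing. nra.
    - apply Rinv_le_contravar; lra. }
  assert (Hr1 : 0 < / r) by (apply Rinv_0_lt_compat; lra).
  assert (Hr2 : 0 < / r ^ 2) by (apply Rinv_0_lt_compat; nra).
  assert (Hdf : forall x, 0 <= x -> Cmod (- RtoC s * / (RtoC x + b) * f x) <= 2 * / r ^ 2).
  { intros x Hx. specialize (Hmod x Hx). specialize (Hfb x Hx).
    rewrite !Cmod_mult, Cmod_opp, Cmod_R, Rabs_pos_eq, Cmod_inv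
      by (lra || apply Re_pos_neq_0, Re_shift_pos; assumption).
    assert (H1 : / Cmod (RtoC x + b) <= / r) by (apply Rinv_le_contravar; lra).
    assert (H2 : 0 < / Cmod (RtoC x + b)) by (apply Rinv_0_lt_compat; lra).
    assert (H3 := Cmod_ge_0 (f x)).
    replace (2 * / r ^ 2) with (2 * / r * / r) by (field; lra).
    apply Rmult_le_compat; [nra|lra|nra|lra]. }
  (* An explicit primitive of f(0) - f(x), whose increment over [0,1] is the quantity to bound. *)
  set (P := fun x => (RtoC x * f 0%R + / (RtoC s - 1) * Cexp ((1 - RtoC s) * Clog (RtoC x + b)))%C).
  assert (HP : forall x, 0 <= x <= 1 -> cderiv P x (f 0%R - f x)%C).
  { intros x [Hx _]. eapply cderiv_eq.
    - apply cderiv_plus.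
      + apply cderiv_mult; [|apply cderiv_const].
        apply cderiv_RtoC, (is_derive_id (K := R_AbsRing)).
      + apply cderiv_scal, cderiv_Cexp, cderiv_scal, cderiv_Clog_shift; assumption.
    - assert (Hx0 := Re_shift_pos b x Hb Hx).
      assert (E : Cexp ((1 - RtoC s) * Clog (RtoC x + b)) = ((RtoC x + b) * f x)%C).
      { replace ((1 - RtoC s) * Clog (RtoC x + b))%C
          with (Clog (RtoC x + b) + - RtoC s * Clog (RtoC x + b))%C by ring.
        rewrite Cexp_plus, Cexp_Clog by (apply Re_pos_neq_0, Hx0). reflexivity. }
      cbv beta. rewrite E. change (RtoC one) with (RtoC 1). field.
      split; [apply Re_pos_neq_0, Hx0|exact Hs1]. }
  assert (H := complex_mean_value_bound P (fun x => f 0%R - f x)%C 0 1 (4 * / r ^ 2) Rle_0_1 HP).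
  replace (8 * / r ^ 2) with (2 * (4 * / r ^ 2) * (1 - 0)) by ring.
  eapply Rle_trans; [right|apply H].
  - f_equal. unfold P, f. rewrite !Cplus_0_l. field. exact Hs1.
  - intros x Hx. rewrite Cmod_minus_sym.
    eapply Rle_trans; [apply (complex_mean_value_bound f (fun x => - RtoC s * / (RtoC x + b) * f x)%C 0 x (2 * / r ^ 2))|].
    + lra.
    + intros y Hy; apply Hf; lra.
    + intros y Hy; apply Hdf; lra.
    + nra.
Qed.

Lemma is_lim_seq_inv_INR : is_lim_seq (fun n => / INR n) 0.
Proof.
  replace (Finite 0) with (Rbar_inv p_infty) by reflexivity.
  apply is_lim_seq_inv; [apply is_lim_seq_INR|discriminate].
Qed.

Lemma hurwitz_near_1_bound (b : C) (Z : C -> C) (m s : R) :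
  2 <= m <= Re b -> 1 < s <= 2 -> is_hurwitz_zeta b Z ->
  Cmod (Z (RtoC s) - Cexp ((1 - RtoC s) * Clog b) / (RtoC s - 1)) <= 8 / (m - 1).
Proof.
  intros Hm Hs HZ.
  assert (Hs1 : (RtoC s - 1)%C <> 0).
  { rewrite <- RtoC_minus. intros E; apply RtoC_inj in E; lra. }
  (* [E n] is the integral of (x+b)^(-s) from n to infinity, so the integrals over unit intervals
     telescope. *)
  set (E := fun n : nat => (/ (RtoC s - 1) * Cexp ((1 - RtoC s) * Clog (RtoC (INR n) + b)))%C).
  set (u := fun n => Cexp (- RtoC s * Clog (RtoC (INR n) + b))%C).
  assert (HE : Ctends eventually E 0).
  { replace (RtoC 0) with (/ (RtoC s - 1) * 0)%C by ring. apply Ctends_scal.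
    apply (Ctends_squeeze _ (fun n => Rpower (INR n) (1 - s))).
    - exists 1%nat. intros n Hn. rewrite Cmod_Cexp.
      assert (Hn1 : 1 <= INR n) by (apply (le_INR 1); lia).
      assert (Hmod : INR n <= Cmod (RtoC (INR n) + b)).
      { assert (H := re_le_Cmod (RtoC (INR n) + b)). assert (H2 := Rle_abs (Re (RtoC (INR n) + b))).
        rewrite re_plus, re_RtoC in H, H2. lra. }
      assert (HR : Re ((1 - RtoC s) * Clog (RtoC (INR n) + b))%C = (1 - s) * ln (Cmod (RtoC (INR n) + b))).
      { rewrite re_mult. unfold Clog; simpl. ring. }
      rewrite HR. unfold Rpower.
      assert (Hln : ln (INR n) <= ln (Cmod (RtoC (INR n) + b))) by (apply ln_le; lra).
      assert (Hle : (1 - s) * ln (Cmod (RtoC (INR n) + b)) <= (1 - s) * ln (INR n)) by nra.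
      destruct Hle as [Hlt|Heq]; [left; apply exp_increasing, Hlt|rewrite Heq; lra].
    - assert (Hln : is_lim_seq (fun n => ln (INR n)) p_infty).
      { exact (filterlim_comp _ _ _ INR ln _ _ _ is_lim_seq_INR is_lim_ln_p). }
      apply (is_lim_seq_scal_l _ (1 - s)) in Hln.
      replace (Rbar_mult (1 - s) p_infty) with m_infty in Hln.
      + exact (filterlim_comp _ _ _ _ exp _ _ _ Hln is_lim_exp_m).
      + symmetry. apply is_Rbar_mult_unique. apply is_Rbar_mult_sym, is_Rbar_mult_p_infty_neg.
        simpl. lra. }
  apply (Ctends_norm_le (F := eventually) (fun n => Csum u n - (E O - E n))%C).
  - apply filter_forall. intros n. rewrite <- Csum_telescope, <- Csum_minus.
    apply Rle_trans with (Rsum (fun k => 8 * / (INR k + m) ^ 2) n).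
    + apply Cmod_Csum_le. intros k. unfold u, E. rewrite S_INR, RtoC_plus.
      replace (RtoC (INR k) + 1 + b)%C with (1 + (RtoC (INR k) + b))%C by ring.
      assert (H := power_increment_bound (RtoC (INR k) + b) (INR k + m) s).
      assert (Hk := pos_INR k). rewrite re_plus, re_RtoC in H.
      eapply Rle_trans; [right|apply H; lra]. f_equal. field. exact Hs1.
    + rewrite Rsum_scal. assert (H := Rsum_inv_sq_le m n). unfold Rdiv.
      apply Rmult_le_compat_l; lra.
  - replace (Cexp ((1 - RtoC s) * Clog b) / (RtoC s - 1))%C with (E O - 0)%C.
    + apply Ctends_minus; [apply hurwitz_tends; [exact HZ|lra]|].
      apply Ctends_minus; [apply Ctends_const|exact HE].
    + unfold E. simpl INR. rewrite Cplus_0_l. field. exact Hs1.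
Qed.

(** The previous bound is uniform in s, so it survives s -> 1. Its comparison term b^(1-s)/(s-1)
    differs from 1/(s-1) by a difference quotient of b^(1-s) at s = 1, with limit -log b. *)
Lemma stieltjes_0_log_bound (b : C) (Z : C -> C) (g : nat -> C) (m : R) :
  2 <= m <= Re b -> is_hurwitz_zeta b Z -> is_stieltjes Z g ->
  Cmod (g O + Clog b) <= 8 / (m - 1).
Proof.
  intros Hm HZ Hg. apply stieltjes_0_limit in Hg.
  assert (Hq : Ctends (at_right 1)
    (fun s : R => (Cexp ((1 - RtoC s) * Clog b) - 1) / (RtoC s - 1))%C (- Clog b)%C).
  { assert (Hc : cderiv (fun s : R => Cexp ((1 - RtoC s) * Clog b)) 1 (- Clog b)%C).
    { eapply cderiv_eq; [apply cderiv_Cexp|].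
      - eapply cderiv_ext; [|apply (cderiv_minus (fun _ => Clog b) (fun t => Clog b * RtoC t)%C)].
        + intros t; simpl; ring.
        + apply cderiv_const.
        + apply cderiv_scal, cderiv_RtoC, (is_derive_id (K := R_AbsRing)).
      - cbv beta. change (RtoC one) with (RtoC 1). replace ((1 - 1) * Clog b)%C with (RtoC 0) by ring.
        rewrite Cexp_0. ring. }
    eapply Ctends_ext; [|apply (cderiv_quotient_at_right _ _ _ Hc)].
    intros s; cbv beta. replace ((1 - 1) * Clog b)%C with (RtoC 0) by ring.
    rewrite Cexp_0, RtoC_minus. reflexivity. }
  replace (g O + Clog b)%C with (g O - - Clog b)%C by ring.
  apply (Ctends_norm_le (F := at_right 1) _ _ _ ) with (2 := Ctends_minus _ _ _ _ Hg Hq).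
  generalize (at_right_between 1 1 Rlt_0_1). apply filter_imp. intros s Hs.
  eapply Rle_trans; [right|apply (hurwitz_near_1_bound b Z m s); [exact Hm|lra|exact HZ]].
  assert (Hs1 : (RtoC s - 1)%C <> 0).
  { rewrite <- RtoC_minus. intros E; apply RtoC_inj in E; lra. }
  f_equal. field. exact Hs1.
Qed.

(** * The asymptotic expansion *)

Lemma Cexp_INR_scal (L : C) (p : nat) : Cexp (RtoC (INR p) * L) = (Cexp L ^ p)%C.
Proof.
  induction p as [|p IH].
  - simpl INR. rewrite Cmult_0_l. apply Cexp_0.
  - rewrite S_INR, RtoC_plus. replace ((INR p + 1) * L)%C with (L + INR p * L)%C by ring.
    rewrite Cexp_plus, IH. reflexivity.
Qed.

Lemma RtoC_Rsum (u : nat -> R) (n : nat) : RtoC (Rsum u n) = Csum (fun k => RtoC (u k)) n.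
Proof. induction n as [|n IH]; simpl; [reflexivity|]. rewrite RtoC_plus, IH. reflexivity. Qed.

Lemma Csum_scal (c : C) (u : nat -> C) (n : nat) :
  Csum (fun k => c * u k)%C n = (c * Csum u n)%C.
Proof. induction n as [|n IH]; simpl; [|rewrite IH]; ring. Qed.

(** At x = 0 every cosine is 1, leaving 2/(2 PI)^p times a partial sum of 1/(k+1)^p. This is where
    the zeta values enter. *)
Lemma cos_sum_0_tends (Z : C -> C) (p : nat) :
  (2 <= p)%nat -> is_hurwitz_zeta 1 Z ->
  Ctends eventually (fun M => RtoC (cos_sum p M 0)) (2 / (2 * PI) ^ p * Z (RtoC (INR p)))%C.
Proof.
  intros Hp HZ. assert (HP := PI_RGT_0).
  assert (Hs : 1 < INR p) by (apply (lt_INR 1); lia).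
  eapply Ctends_ext; [|apply Ctends_scal, (hurwitz_tends 1 Z (INR p) HZ Hs)].
  intros M. cbv beta. unfold cos_sum. rewrite RtoC_Rsum, <- Csum_scal. apply Csum_ext.
  intros k. rewrite Rmult_0_r, cos_0.
  assert (Hk : 0 < INR k + 1) by (assert (H := pos_INR k); lra).
  rewrite <- RtoC_plus.
  replace (- RtoC (INR p) * Clog (RtoC (INR k + 1)))%C
    with (- (RtoC (INR p) * Clog (RtoC (INR k + 1))))%C by ring.
  rewrite Cexp_opp, Cexp_INR_scal, Cexp_Clog by (intros E; apply RtoC_inj in E; lra).
  unfold freq. rewrite S_INR, <- RtoC_mult, <- !RtoC_pow.
  assert (H1 : (2 * PI) ^ p <> 0) by (apply pow_nonzero; lra).
  assert (H2 : (INR k + 1) ^ p <> 0) by (apply pow_nonzero; lra).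
  rewrite <- RtoC_inv, <- RtoC_div, <- RtoC_mult by assumption.
  f_equal. rewrite (Rpow_mult_distr (2 * PI)).
  set (x := (2 * PI) ^ p) in *. set (y := (INR k + 1) ^ p) in *. field. split; assumption.
Qed.

(** All summands are positive, so the sums stay above the first one. This gives zeta(2N+2) <> 0;
    otherwise domination by the last retained term would demand a zero remainder. *)
Lemma cos_sum_0_limit_neq_0 (p : nat) (l : C) :
  Ctends eventually (fun M => RtoC (cos_sum p M 0)) l -> l <> 0.
Proof.
  intros H ->.
  assert (Hpos : forall k, 0 < 2 * cos (freq k * 0) / freq k ^ p).
  { intros k. rewrite Rmult_0_r, cos_0. apply Rdiv_lt_0_compat; [lra|apply pow_lt, freq_pos]. }
  destruct (H _ (Hpos 0%nat)) as [N HN]. specialize (HN (1 + N)%nat ltac:(lia)).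
  replace (RtoC (cos_sum p (1 + N) 0) - 0)%C with (RtoC (cos_sum p (1 + N) 0)) in HN by ring.
  rewrite Cmod_R in HN. unfold cos_sum in HN. rewrite Rsum_add in HN. cbn [Rsum] in HN.
  assert (H0 : 0 <= Rsum (fun k => 2 * cos (freq (1 + k) * 0) / freq (1 + k) ^ p) N).
  { clear -Hpos. induction N as [|N IH]; cbn [Rsum]; [lra|]. specialize (Hpos (1 + N)%nat). lra. }
  match type of HN with Rabs ?x < _ => assert (Hx := Rle_abs x) end.
  cbv beta in *. lra.
Qed.

Lemma Cpow_inv_shift_tends (a : C) (k : nat) :
  0 < Re a -> Ctends eventually (fun m => (/ (RtoC (INR m) + a)) ^ S k)%C 0.
Proof.
  intros Ha. apply (Ctends_squeeze _ (fun m => / INR m)); [|exact is_lim_seq_inv_INR].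
  exists 1%nat. intros m Hm.
  assert (Hm1 : 1 <= INR m) by (apply (le_INR 1); lia).
  assert (Hmod : INR m <= Cmod (RtoC (INR m) + a)).
  { assert (H := re_le_Cmod (RtoC (INR m) + a)). assert (H2 := Rle_abs (Re (RtoC (INR m) + a))).
    rewrite re_plus, re_RtoC in H, H2. lra. }
  assert (Hne : (RtoC (INR m) + a)%C <> 0) by (apply Re_pos_neq_0, Re_shift_pos; lra).
  rewrite Cmod_pow, Cmod_inv by exact Hne.
  assert (Hi : / Cmod (RtoC (INR m) + a) <= / INR m) by (apply Rinv_le_contravar; lra).
  assert (Hi0 : 0 < / Cmod (RtoC (INR m) + a)) by (apply Rinv_0_lt_compat; lra).
  assert (Hi1 : / Cmod (RtoC (INR m) + a) <= 1).
  { rewrite <- Rinv_1. apply Rinv_le_contravar; lra. }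
  assert (Hk : (/ Cmod (RtoC (INR m) + a)) ^ k <= 1).
  { rewrite <- (pow1 k). apply pow_incr. lra. }
  simpl. assert (Hk0 : 0 <= (/ Cmod (RtoC (INR m) + a)) ^ k) by (apply pow_le; lra). nra.
Qed.

(** The cross term 2x Re a is nonnegative, and x^2 + |a|^2 >= (x+|a|)^2/2. Sums over shifts of a
    thus reduce to real sums in |a| alone, however small Re a is. *)
Lemma Cmod_shift_sum_ge (a : C) (x : R) :
  0 < Re a -> 0 <= x -> (x + Cmod a) ^ 2 <= 2 * Cmod (RtoC x + a) ^ 2.
Proof.
  intros Ha Hx. rewrite Cmod2_alt, re_plus, im_plus, re_RtoC, im_RtoC.
  assert (H := Cmod2_alt a).
  assert (H0 := Rmult_le_pos _ _ Hx (Rlt_le _ _ Ha)). assert (H1 := pow2_ge_0 (x - Cmod a)). lra.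
Qed.

Section Expansion.
Variables (zeta : C -> C -> C) (gamma : nat -> C -> C).
Hypothesis zetaP : forall a : C, 0 < Re a -> is_hurwitz_zeta a (fun s : C => zeta s a).
Hypothesis gammaP : forall a : C, 0 < Re a ->
  is_stieltjes (fun s : C => zeta s a) (fun n : nat => gamma n a).

(** By Euler's formula this is |B_(2n+2)|/(2n+2)!. *)
Definition even_zeta_coeff (n : nat) : C :=
  (2 / (2 * PI) ^ (2 * n + 2) * zeta (RtoC (INR (2 * n + 2))) 1)%C.

Definition gamma0_term (n : nat) (a : C) : C :=
  ((-1) ^ n * even_zeta_coeff n * INR (fact (2 * n + 1)) * (/ a) ^ (2 * n + 2))%C.

Definition gamma0_remainder (N : nat) (a : C) : C :=
  (gamma O a - (1 / (2 * a) - Clog a + Csum (fun n => gamma0_term n a) (S N)))%C.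

Lemma one_right_half_plane : 0 < Re 1.
Proof. simpl. lra. Qed.

Lemma even_zeta_coeff_tends (n : nat) :
  Ctends eventually (fun M => RtoC (cos_sum (2 * n + 2) M 0)) (even_zeta_coeff n).
Proof.
  apply (cos_sum_0_tends (fun s => zeta s 1)); [lia|]. apply zetaP, one_right_half_plane.
Qed.

(** Euler-Maclaurin with [F] the logarithm and [d 0] = 1/(x+b). The trapezoid mean of 1/b and
    1/(1+b) is 1/b, the difference of gamma_0, minus the difference of the terms 1/(2a); the odd
    derivatives -(2n+1)!/(x+b)^(2n+2) reproduce the terms of the expansion. *)
Lemma gamma0_remainder_difference (N : nat) (b : C) :
  0 < Re b ->
  Cmod (gamma0_remainder N b - gamma0_remainder N (1 + b)) <= 4 * INR (fact (2 * N + 3)) / Cmod b ^ (2 * N + 4).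
Proof.
  intros Hb. assert (Hb1 : 0 < Re (1 + b)) by (rewrite re_plus, re_RtoC; lra).
  assert (Hne := Re_pos_neq_0 b Hb). assert (Hne1 := Re_pos_neq_0 _ Hb1).
  assert (Hm := Cmod_pos b Hb).
  set (d := inv_deriv b). set (F := fun t : R => Clog (RtoC t + b)).
  set (B0 := INR (fact 2) / Cmod b ^ 3). set (B1 := INR (fact (2 * N + 3)) / Cmod b ^ (2 * N + 4)).
  set (E := fun k : nat -> C => ((d O 0%R + d O 1%R) / 2 - (F 1%R - F 0%R)
    - Csum (fun n => (-1) ^ n * k n * (d (2 * n + 1)%nat 1%R - d (2 * n + 1)%nat 0%R)) (S N))%C).
  assert (Hlim : Ctends eventually (fun M => E (fun n => RtoC (cos_sum (2 * n + 2) M 0))) (E even_zeta_coeff)).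
  { apply Ctends_minus; [apply Ctends_const|].
    apply (Ctends_Csum (fun n M => (-1) ^ n * RtoC (cos_sum (2 * n + 2) M 0)
       * (d (2 * n + 1)%nat 1%R - d (2 * n + 1)%nat 0%R))%C
      (fun n => (-1) ^ n * even_zeta_coeff n * (d (2 * n + 1)%nat 1%R - d (2 * n + 1)%nat 0%R))%C).
    intros n. set (D := (d (2 * n + 1)%nat 1%R - d (2 * n + 1)%nat 0%R)%C).
    replace ((-1) ^ n * even_zeta_coeff n * D)%C with ((-1) ^ n * D * even_zeta_coeff n)%C by ring.
    eapply Ctends_ext; [|apply Ctends_scal, even_zeta_coeff_tends]. intros M; cbv beta. ring. }
  assert (HE : Cmod (E even_zeta_coeff) <= 4 * B1).
  { apply le_epsilon. intros eps Heps.
    apply (Ctends_norm_le (F := eventually)) with (2 := Hlim).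
    destruct (INR_eventually_large (4 * B0 / eps)) as [p Hp].
    exists (S p). intros M HM.
    eapply Rle_trans; [apply (euler_maclaurin F d M N B0 B1)|].
    - lia.
    - intros x Hx. eapply cderiv_eq; [apply cderiv_Clog_shift; [exact Hb|lra]|].
      unfold d, inv_deriv. simpl. field. apply Re_pos_neq_0, Re_shift_pos; [exact Hb|lra].
    - intros j x Hx. apply cderiv_inv_deriv; [exact Hb|lra].
    - intros x Hx. apply Cmod_inv_deriv_le; [exact Hb|lra].
    - intros x Hx. unfold B1. replace (2 * N + 4)%nat with (S (2 * N + 3)) by lia.
      apply Cmod_inv_deriv_le; [exact Hb|lra].
    - assert (HpM : INR p <= INR M) by (apply le_INR; lia).
      assert (HM0 : 0 < INR M) by (apply (lt_INR 0); lia).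
      assert (H4 : 4 * B0 / INR M <= eps); [|lra].
      apply <- Rle_div_l; [|lra].
      apply (Rle_div_l (4 * B0) (INR p) eps) in Hp; [|lra]. nra. }
  replace (4 * INR (fact (2 * N + 3)) / Cmod b ^ (2 * N + 4)) with (4 * B1)
    by (unfold B1, Rdiv; ring).
  replace (gamma0_remainder N b - gamma0_remainder N (1 + b))%C with (E even_zeta_coeff); [exact HE|].
  assert (Hg := stieltjes_0_shift b _ _ _ _ Hb (zetaP _ Hb) (zetaP _ Hb1) (gammaP _ Hb) (gammaP _ Hb1)).
  cbv beta in Hg.
  assert (HS : Csum (fun n => (-1) ^ n * even_zeta_coeff n * (d (2 * n + 1)%nat 1%R - d (2 * n + 1)%nat 0%R))%C (S N)
    = (Csum (fun n => gamma0_term n b) (S N) - Csum (fun n => gamma0_term n (1 + b)%C) (S N))%C).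
  { rewrite <- Csum_minus. apply Csum_ext. intros n. unfold gamma0_term, d, inv_deriv.
    replace (S (2 * n + 1)) with (2 * n + 2)%nat by lia.
    assert (Hodd : ((-1) ^ (2 * n + 1) = -1)%C).
    { rewrite Cpow_add_r, Cpow_mult_r. replace ((-1) ^ 2)%C with (RtoC 1) by (simpl; ring).
      rewrite Cpow_1_l, Cpow_1_r. ring. }
    rewrite Hodd, !Cplus_0_l. ring. }
  unfold E, gamma0_remainder. rewrite HS. unfold F. rewrite Cplus_0_l.
  replace (gamma O b) with (gamma O (1 + b)%C + / b)%C by (rewrite <- Hg; ring).
  unfold d, inv_deriv. simpl. rewrite Cplus_0_l. field.
  split; assumption.
Qed.

Lemma gamma0_remainder_shift_tends (N : nat) (a : C) :
  0 < Re a -> Ctends eventually (fun m => gamma0_remainder N (RtoC (INR m) + a)) 0.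
Proof.
  intros Ha.
  assert (Hne : forall m, (RtoC (INR m) + a)%C <> 0).
  { intros m. apply Re_pos_neq_0, Re_shift_pos; [exact Ha|apply pos_INR]. }
  assert (Hlog : Ctends eventually (fun m => gamma O (RtoC (INR m) + a) + Clog (RtoC (INR m) + a))%C 0).
  (* For m >= 2 the bound 8/(m-1) is at most 16/m. *)
  { apply (Ctends_squeeze _ (fun m => 16 * / INR m)).
    - exists 2%nat. intros m Hm. assert (Hm2 : 2 <= INR m) by (apply (le_INR 2); lia).
      assert (Hre : 0 < Re (RtoC (INR m) + a)) by (apply Re_shift_pos; lra).
      eapply Rle_trans; [apply (stieltjes_0_log_bound _ _ _ (INR m)) with (2 := zetaP _ Hre) (3 := gammaP _ Hre)|].
      + rewrite re_plus, re_RtoC. lra.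
      + apply <- Rle_div_l; [|lra]. apply Rmult_le_reg_r with (INR m); [lra|].
        replace (16 * / INR m * (INR m - 1) * INR m) with (16 * (INR m - 1)) by (field; lra). lra.
    - assert (H := is_lim_seq_scal_l _ 16 _ is_lim_seq_inv_INR).
      replace (Rbar_mult 16 0) with (Finite 0) in H by (simpl; f_equal; ring). exact H. }
  assert (Hsum : Ctends eventually (fun m => Csum (fun n => gamma0_term n (RtoC (INR m) + a)%C) (S N))
    (* The zero limit is written as a product so that [Csum_scal] can pull out a factor 0. *)
    (Csum (fun _ => 0 * 0)%C (S N))).
  { apply (Ctends_Csum (fun n m => gamma0_term n (RtoC (INR m) + a)%C)). intros n.
    replace (0 * 0)%C with ((-1) ^ n * even_zeta_coeff n * INR (fact (2 * n + 1)) * 0)%C by ring.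
    apply Ctends_scal. replace (2 * n + 2)%nat with (S (2 * n + 1)) by lia.
    apply Cpow_inv_shift_tends, Ha. }
  rewrite Csum_scal in Hsum.
  assert (Hinv := Ctends_scal (/ 2) _ _ (Cpow_inv_shift_tends a 0 Ha)).
  replace (RtoC 0) with (0 - / 2 * 0 - 0 * Csum (fun _ => 0%C) (S N))%C by ring.
  eapply Ctends_ext; [|apply Ctends_minus; [apply Ctends_minus; [exact Hlog|exact Hinv]|exact Hsum]].
  intros m. unfold gamma0_remainder. cbv beta. rewrite Cpow_1_r. field. apply Hne.
Qed.

(** Of the 2N+4 powers of 1/|a+j|, all but two are bounded by powers of 1/|a|; the last two are
    summed over j and give 1/(|a|-1). The constant 8 is 4 times the 2 of [Cmod_shift_sum_ge]. *)
Lemma gamma0_remainder_bound (N : nat) (a : C) :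
  0 < Re a -> 1 < Cmod a ->
  Cmod (gamma0_remainder N a) <= 8 * INR (fact (2 * N + 3)) / (Cmod a ^ (2 * N + 2) * (Cmod a - 1)).
Proof.
  intros Ha HA. set (K := INR (fact (2 * N + 3))).
  assert (HK : 0 < K) by (apply (lt_INR 0), lt_O_fact).
  assert (HAp : 0 < Cmod a ^ (2 * N + 2)) by (apply pow_lt; lra).
  assert (Hlim : Ctends eventually (fun m => gamma0_remainder N a - gamma0_remainder N (RtoC (INR m) + a))%C (gamma0_remainder N a - 0)%C).
  { apply Ctends_minus; [apply Ctends_const|apply gamma0_remainder_shift_tends, Ha]. }
  replace (gamma0_remainder N a - 0)%C with (gamma0_remainder N a) in Hlim by ring.
  apply (Ctends_norm_le (F := eventually)) with (2 := Hlim).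
  apply filter_forall. intros m.
  set (u := fun j => gamma0_remainder N (RtoC (INR j) + a)).
  replace (gamma0_remainder N a) with (u O) by (unfold u; simpl INR; rewrite Cplus_0_l; reflexivity).
  change (gamma0_remainder N (RtoC (INR m) + a)) with (u m). rewrite <- Csum_telescope.
  apply Rle_trans with (Rsum (fun j => 8 * K / Cmod a ^ (2 * N + 2) * / (INR j + Cmod a) ^ 2) m).
  - apply Cmod_Csum_le. intros j. unfold u. assert (Hj := pos_INR j).
    rewrite S_INR, RtoC_plus.
    replace (RtoC (INR j) + 1 + a)%C with (1 + (RtoC (INR j) + a))%C by ring.
    eapply Rle_trans; [apply gamma0_remainder_difference, Re_shift_pos; assumption|]. fold K.
    assert (H2 := Cmod_shift_sum_ge a (INR j) Ha Hj).
    assert (H3 := Cmod_shift_ge a (INR j) Ha Hj).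
    set (R := Cmod (RtoC (INR j) + a)) in *.
    assert (Hsq : 0 < (INR j + Cmod a) ^ 2) by (apply pow_lt; lra).
    assert (Hp : Cmod a ^ (2 * N + 2) <= R ^ (2 * N + 2)) by (apply pow_incr; lra).
    replace (8 * K / Cmod a ^ (2 * N + 2) * / (INR j + Cmod a) ^ 2)
      with (4 * K * / (Cmod a ^ (2 * N + 2) * ((INR j + Cmod a) ^ 2 / 2)))
      by (field; repeat split; lra).
    unfold Rdiv. apply Rmult_le_compat_l; [lra|].
    apply Rinv_le_contravar; [apply Rmult_lt_0_compat; lra|].
    replace (2 * N + 4)%nat with (2 * N + 2 + 2)%nat by lia. rewrite (pow_add R).
    apply Rmult_le_compat; lra.
  - rewrite Rsum_scal. assert (H := Rsum_inv_sq_le (Cmod a) m HA).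
    replace (8 * K / (Cmod a ^ (2 * N + 2) * (Cmod a - 1)))
      with (8 * K / Cmod a ^ (2 * N + 2) * / (Cmod a - 1)) by (field; split; lra).
    apply Rmult_le_compat_l; [|exact H].
    apply Rlt_le, Rdiv_lt_0_compat; lra.
Qed.

Lemma gamma0_term_eq (n : nat) (a : C) :
  0 < Re a ->
  (1 / (2 * PI ^ 2 * a ^ 2) *
     (INR (fact (2 * n + 1)) * (-1) ^ n / (2 * PI * a) ^ (2 * n) *
      zeta (INR (2 * n + 2)) 1))%C = gamma0_term n a.
Proof.
  intros Ha. assert (Hne := Re_pos_neq_0 a Ha). assert (HP := PI_RGT_0).
  assert (HPne : RtoC PI <> 0) by (intros E; apply RtoC_inj in E; lra).
  unfold gamma0_term, even_zeta_coeff. rewrite !Cpow_mult_l, Cpow_inv, !Cpow_add_r by exact Hne.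
  assert (H2 : (2 ^ (2 * n))%C <> 0).
  { apply Cpow_nz. intros E; apply RtoC_inj in E; lra. }
  assert (H3 := Cpow_nz _ (2 * n) HPne). assert (H4 := Cpow_nz _ (2 * n) Hne).
  set (x := (2 ^ (2 * n))%C) in *. set (y := (PI ^ (2 * n))%C) in *.
  set (z := (a ^ (2 * n))%C) in *. set (e := ((-1) ^ n)%C).
  simpl Cpow. field. repeat split; assumption.
Qed.

End Expansion.

Theorem proposition1 :
  forall (zeta : C -> C -> C) (gamma : nat -> C -> C),
    (forall a : C, 0 < Re a -> is_hurwitz_zeta a (fun s : C => zeta s a)) ->
    (forall a : C, 0 < Re a ->
       is_stieltjes (fun s : C => zeta s a) (fun n : nat => gamma n a)) ->
    asymptotic_expansion right_half_plane_infinity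
      (gamma 0%nat)
      (fun a : C => 1 / (2 * a) - Clog a)%C
      (fun (n : nat) (a : C) =>
         1 / (2 * PI ^ 2 * a ^ 2) *
         (INR (fact (2 * n + 1)) * (-1) ^ n / (2 * PI * a) ^ (2 * n) *
          zeta (INR (2 * n + 2)) 1))%C.
Proof.
  intros zeta gamma zetaP gammaP N [eps Heps].
  assert (Hkap := cos_sum_0_limit_neq_0 _ _ (even_zeta_coeff_tends zeta zetaP N)). apply Cmod_gt_0 in Hkap.
  set (K := INR (fact (2 * N + 3))). set (K' := INR (fact (2 * N + 1))).
  assert (HK : 0 < K) by (apply (lt_INR 0), lt_O_fact).
  assert (HK' : 0 < K') by (apply (lt_INR 0), lt_O_fact).
  assert (HD : 0 < eps * (Cmod (even_zeta_coeff zeta N) * K')).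
  { apply Rmult_lt_0_compat; [exact Heps|]. apply Rmult_lt_0_compat; assumption. }
  assert (HQ : 0 < 8 * K / (eps * (Cmod (even_zeta_coeff zeta N) * K'))) by (apply Rdiv_lt_0_compat; lra).
  (* Once the common factor |a|^(-2N-2) is cancelled, the claim is that 8K/(|a|-1) is at most eps
     times the modulus of the last coefficient; the threshold solves this for |a| and also ensures
     |a| > 1. *)
  exists (1 + 8 * K / (eps * (Cmod (even_zeta_coeff zeta N) * K'))). intros a Hbig Ha.
  assert (Hne := Re_pos_neq_0 a Ha).
  assert (HA : 1 < Cmod a) by lra.
  change (Cmod (gamma O a - (1 / (2 * a) - Clog a + sum_n (G := C_AbelianMonoid) (fun n : nat =>
       1 / (2 * PI ^ 2 * a ^ 2) *
       (INR (fact (2 * n + 1)) * (-1) ^ n / (2 * PI * a) ^ (2 * n) *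
        zeta (INR (2 * n + 2)) 1)) N))%C
    <= eps * Cmod (1 / (2 * PI ^ 2 * a ^ 2) *
       (INR (fact (2 * N + 1)) * (-1) ^ N / (2 * PI * a) ^ (2 * N) *
        zeta (INR (2 * N + 2)) 1))%C).
  rewrite sum_n_Csum, (Csum_ext _ (fun n => gamma0_term zeta n a)) by (intros n; apply gamma0_term_eq, Ha).
  rewrite gamma0_term_eq by exact Ha. fold (gamma0_remainder zeta gamma N a).
  eapply Rle_trans; [apply gamma0_remainder_bound; assumption|]. fold K.
  unfold gamma0_term. rewrite !Cmod_mult, !Cmod_pow, Cmod_inv, !Cmod_R by exact Hne. fold K'.
  rewrite (Rabs_left (-1)) by lra. replace (- -1) with 1 by ring.
  rewrite pow1, (Rabs_pos_eq K') by lra.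
  assert (HAp : 0 < Cmod a ^ (2 * N + 2)) by (apply pow_lt; lra).
  rewrite pow_inv.
  replace (8 * K / (Cmod a ^ (2 * N + 2) * (Cmod a - 1)))
    with (8 * K / (Cmod a - 1) * / Cmod a ^ (2 * N + 2)) by (field; split; lra).
  rewrite Rmult_1_l, <- !Rmult_assoc. apply Rmult_le_compat_r; [left; apply Rinv_0_lt_compat, HAp|].
  apply <- Rle_div_l; [|lra].
  assert (Hb : 8 * K / (eps * (Cmod (even_zeta_coeff zeta N) * K')) <= Cmod a - 1) by lra.
  apply -> Rle_div_l in Hb; [|exact HD]. lra.
Qed.
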